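(* Let $n\ge2$, $\frac34<a\le1$, $b=\frac12$, and $0<c_0\le1$. If $F$ is the $(a,b)$-set of divergence (a ''set of type II''), then $$\dim_H\big(F\cap[0,c_0]^n\big)\ge\alpha:=1+(n-1)a.$$
   Context: For $k\ge k_0$ let $R_k=2^k$, $D_k=R_k^{(n-(n-1)a+nb)/(n+1)}$, $Q_k=R_k^{\frac{n-1}{n+1}(2a-b-1)}$. A point $(p_1/q,\dots,p_n/q)$, $p_j,q\in\mathbb{Z}$, is an admissible fraction if $\gcd(p_1,q)=1$ and: $p_2,\dots,p_n$ arbitrary when $q$ is odd; all even when $q\equiv0\pmod4$; all odd when $q\equiv2\pmod4$. Fix $0<c\ll1$. Let $\mathcal{A}_k$ be the collection of axis-parallel boxes (''slabs'') of dimensions $cR_k^{-1/2}\times cR_k^{-1}\times\cdots\times cR_k^{-1}$ (long side in the $x_1$ direction) centered at $\big(2p_1R_k/(qD_k^2),p_2/(D_kq),\dots,p_n/(D_kq)\big)$ with $(p_1/q,\dots,p_n/q)$ admissible and $1\le q\le Q_k$; $F_k=\bigcup_{s\in\mathcal{A}_k}s$ and $F=\limsup_{k\to\infty}F_k=\bigcap_N\bigcup_{k\ge N}F_k$. $\dim_H$ denotes Hausdorff dimension. *)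

(* Defs.v *)
From HB Require Import structures.
From mathcomp Require Import all_boot all_order all_algebra.
From mathcomp Require Import all_classical all_reals all_analysis.
Unset Printing Implicit Defensive.
Import Order.TTheory GRing.Theory Num.Theory.
Local Open Scope classical_set_scope.
Local Open Scope ring_scope.

Section Defs.
Variable R : realType.

Definition edist (n : nat) (x y : 'I_n -> R) : R :=
  Num.sqrt (\sum_(i < n) (x i - y i) ^+ 2).

(** Diameter (in \bar R); the diameter of the empty set is 0. *)
Definition diam (n : nat) (U : set ('I_n -> R)) : \bar R :=
  ereal_sup ([set 0%E] `|` [set (edist n x y)%:E | x in U & y in U]).

Definition hausdorff_approx (n : nat) (s delta : R) (E : set ('I_n -> R)) : \bar R :=
  ereal_inf [set S | exists U : nat -> set ('I_n -> R),
     [/\ E `<=` \bigcup_i U i, (forall i, (diam n (U i) <= delta%:E)%E) &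
         S = (\sum_(0 <= i <oo) ((fine (diam n (U i))) `^ s)%:E)%E]].

Definition hausdorff_measure (n : nat) (s : R) (E : set ('I_n -> R)) : \bar R :=
  ereal_sup [set hausdorff_approx n s delta E | delta in [set d : R | 0 < d]].

Definition hausdorff_dim (n : nat) (E : set ('I_n -> R)) : \bar R :=
  ereal_inf [set s%:E | s in [set s : R | 0 <= s /\ hausdorff_measure n s E = 0%E]].

(** Admissible fractions (p_1/q, ..., p_n/q); p 0 is p_1, p j is p_{j+1}
    for 1 <= j <= n-1 (other values of p are irrelevant). *)
Definition admissible (n : nat) (p : nat -> int) (q : nat) : Prop :=
  [/\ coprimez (p 0%N) (q%:Z),
      (q %% 4 = 0)%N -> forall j, (1 <= j < n)%N -> (2 %| p j)%Z &
      (q %% 4 = 2)%N -> forall j, (1 <= j < n)%N -> ~~ (2 %| p j)%Z].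

Definition Rk (k : nat) : R := 2 ^+ k.
Definition Dk (n : nat) (a b : R) (k : nat) : R :=
  Rk k `^ ((n%:R - (n%:R - 1) * a + n%:R * b) / (n%:R + 1)).
Definition Qk (n : nat) (a b : R) (k : nat) : R :=
  Rk k `^ ((n%:R - 1) / (n%:R + 1) * (2 * a - b - 1)).

Definition slab_center (n : nat) (a b : R) (k : nat) (p : nat -> int) (q : nat)
    (i : 'I_n) : R :=
  if (i : nat) == 0%N then 2 * (p 0%N)%:~R * Rk k / (q%:R * Dk n a b k ^+ 2)
  else (p i)%:~R / (Dk n a b k * q%:R).

Definition slab (n : nat) (a b c : R) (k : nat) (p : nat -> int) (q : nat) :
    set ('I_n -> R) :=
  [set x | forall i : 'I_n,
     `|x i - slab_center n a b k p q i| <=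
       (if (i : nat) == 0%N then c * (Rk k `^ (- (1/2))) else c * (Rk k)^-1) / 2].

Definition Fk (n : nat) (a b c : R) (k : nat) : set ('I_n -> R) :=
  [set x | exists (p : nat -> int) (q : nat),
     [/\ admissible n p q, (1 <= q)%N, q%:R <= Qk n a b k & slab n a b c k p q x]].

Definition Fdiv (n : nat) (a b c : R) (k0 : nat) : set ('I_n -> R) :=
  [set x | forall N : nat, exists k : nat, [/\ (N <= k)%N, (k0 <= k)%N & Fk n a b c k x]].

Definition cube (n : nat) (c0 : R) : set ('I_n -> R) :=
  [set x | forall i : 'I_n, 0 <= x i <= c0].

End Defs.
Arguments edist {R n}.
Arguments diam {R n}.
Arguments hausdorff_approx {R n}.
Arguments hausdorff_measure {R n}.
Arguments hausdorff_dim {R n}.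
Arguments admissible n p q.
Arguments Rk {R}.
Arguments Dk {R}.
Arguments Qk {R}.
Arguments slab_center {R}.
Arguments slab {R}.
Arguments Fk {R}.
Arguments Fdiv {R}.
Arguments cube {R}.

(* Main.v *)
Require Import Defs.
From HB Require Import structures.
From mathcomp Require Import all_boot all_order all_algebra.
From mathcomp Require Import all_classical all_reals all_analysis.
From mathcomp Require Import zify ring lra.
Import Order.TTheory GRing.Theory Num.Theory.

Set Implicit Arguments.
Unset Strict Implicit.
Unset Printing Implicit Defensive.

(** Write n = m + 1, R = 2^k, and let s < 1 + m a. Every box contains, for k large, many slabs of
    F_k that are spread out like a grid with cells R^(-1/2+e) x R^(-a) x ... x R^(-a):
    - simultaneous Dirichlet approximation (pigeonhole) of a grid point y - (1/2, ..., 1/2) by s / t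
      gives the denominator q = 2 t and the numerators p_j = t + 2 s_j (up to multiples of q), which
      satisfy the parity conditions automatically; at most half of the grid points have an
      approximation with t much smaller than Q;
    - a numerator p_1 coprime to q is found in every window of length 2 * 4^omega(q) = O(q^e), by
      sieving.
    For each level-k slab S let the gauge h_S(r) bound the portion of S that a set of diameter r can
    occupy, with h_S(r) = 1 as soon as r is large compared with R^(-1/2). Given sets U_i covering F
    with small total s-dimensional size, start from the cube and go down: whenever the sum of
    h_B(diam U_i) over the U_i meeting a box B is below 1, counting the slabs inside B that meet
    each U_i and averaging yields a slab S in B for which the sum of h_S(diam U_i) is again below 1.
    The nested slabs shrink to a point of F; if it belonged to U_i, then h_S(diam U_i) = 1 at a deep
    level, which contradicts the bound on the sums. *)

(** * Sieving and simultaneous approximation *)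

Section Sieve.

Definition sifted (ps : seq nat) (y : nat) : bool := all (fun p => ~~ (p %| y)) ps.

Definition sifted_count (ps : seq nat) (X : nat) : nat := count (sifted ps) (iota 0 X).

Lemma sifted_countS ps X : sifted_count ps X.+1 = sifted_count ps X + sifted ps X.
Proof. by rewrite /sifted_count -addn1 iotaD count_cat /= addn0. Qed.

(** Legendre's recursion. The survivors of [ps] that [p] removes are the multiples [p * y] with [y]
    below the ceiling of [X / p]; as [p] is a prime outside [ps], [p * y] survives [ps] exactly when
    [y] does. *)
Lemma sifted_count_cons p ps X : prime p -> all prime ps -> p \notin ps ->
  sifted_count (p :: ps) X + sifted_count ps ((X + p.-1) %/ p) = sifted_count ps X.
Proof.
move=> pp pps pnps; have p_gt0 := prime_gt0 pp.
have mulK y : sifted ps (p * y) = sifted ps y.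
  apply: eq_in_all => l lps; rewrite Euclid_dvdM ?(allP pps l lps)//.
  by rewrite dvdn_prime2 ?(allP pps l lps)//; case: eqP => // lp; rewrite -lp lps in pnps.
elim: X => [|X IH].
  by rewrite add0n divn_small ?prednK// /sifted_count.
rewrite !sifted_countS -IH /= -/(sifted ps X).
have [/dvdnP[y Xy]|npX] := boolP (p %| X).
  have -> : (X.+1 + p.-1) %/ p = y.+1.
    by rewrite Xy addSnnS prednK// -mulSnr mulnK.
  have -> : (X + p.-1) %/ p = y by rewrite Xy divnMDl// divn_small ?prednK ?addn0.
  rewrite sifted_countS Xy (mulnC y) mulK.
  by lia.
have -> : (X.+1 + p.-1) %/ p = (X + p.-1) %/ p.
  have r0 : 0 < X %% p by rewrite lt0n; move: npX; rewrite /dvdn.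
  have rp := ltn_pmod X p_gt0.
  have -> : X.+1 + p.-1 = (X %/ p).+1 * p + X %% p by rewrite {1}(divn_eq X p); lia.
  have -> : X + p.-1 = (X %/ p).+1 * p + (X %% p).-1 by rewrite {1}(divn_eq X p); lia.
  rewrite !divnMDl// (divn_small rp) [(_ %% _).-1 %/ _]divn_small//.
  exact: leq_ltn_trans (leq_pred _) rp.
by lia.
Qed.

Local Open Scope ring_scope.
(** Induction by Legendre's recursion: the new error is at most two old errors plus 1 for rounding
    [X / p] up, and [2 * (2 ^ k - 1) + 1 = 2 ^ k.+1 - 1]. *)
Lemma sifted_count_approx (R : realFieldType) ps X : uniq ps -> all prime ps ->
  `|(sifted_count ps X)%:R - X%:R * \prod_(p <- ps) (1 - p%:R^-1)| <= 2 ^+ size ps - 1 :> R.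
Proof.
elim: ps X => [|p ps IH] X.
  move=> _ _; rewrite big_nil mulr1 /sifted_count /sifted count_predT size_iota.
  by rewrite subrr normr0 expr0 subrr.
move=> /= /andP[pnps ups] /andP[pp pps].
have := sifted_count_cons X pp pps pnps.
set Y := ((X + p.-1) %/ p)%N => /(congr1 (fun z : nat => z%:R : R)); rewrite natrD => E.
rewrite big_cons.
have := IH X ups pps; have := IH Y ups pps; move: E.
set P := \prod_(_ <- _) _; set a := (_ (p :: ps) _)%:R; set b := _%:R; set c := _%:R => E.
have P01 : 0 <= P <= 1.
  rewrite /P big_seq; elim/big_ind: _ => [|x y /andP[x0 x1] /andP[y0 y1]|l /(allP pps) lp].
  - by rewrite ler01 lexx.
  - by rewrite mulr_ge0// mulr_ile1.
  - by rewrite subr_ge0 invf_le1 ?ler1n ?ltr0n ?prime_gt0// gerBl invr_ge0 ler0n.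
have p0 : 0 < p%:R :> R by rewrite ltr0n prime_gt0.
have Yp : X%:R * p%:R^-1 <= Y%:R :> R.
  rewrite ler_pdivrMr// -natrM ler_nat /Y.
  have := divn_eq (X + p.-1) p; have := ltn_pmod (X + p.-1) (prime_gt0 pp).
  by have := prime_gt0 pp; lia.
have Yp' : Y%:R - 1 <= X%:R * p%:R^-1 :> R.
  have -> : X%:R * p%:R^-1 = (X + p)%:R / p%:R - 1 :> R.
    by rewrite natrD mulrDl divff ?gt_eqF// addrK.
  rewrite lerB// ler_pdivlMr// -natrM ler_nat /Y.
  by have := leq_trunc_div (X + p.-1) p; have := prime_gt0 pp; lia.
move: P01 => /andP[P0 P1].
rewrite exprS.
move=> h1 h2.
have -> : a - X%:R * ((1 - p%:R^-1) * P)
    = (c - X%:R * P) - (b - Y%:R * P) - (Y%:R - X%:R * p%:R^-1) * P.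
  by rewrite -E; ring.
have h3 : `|(Y%:R - X%:R * p%:R^-1) * P| <= 1.
  rewrite ger0_norm; last by rewrite mulr_ge0// subr_ge0.
  by apply: mulr_ile1 => //; [rewrite subr_ge0|lra].
apply: (le_trans (ler_normB _ _)); apply: (le_trans (lerD (ler_normB _ _) h3)).
by lra.
Qed.

(** Each factor [1 - 1 / p] is at least 1/2, so with [k] primes the main term of the window is at
    least [2 * 2 ^ k], while the counts at its two ends err together by at most
    [2 * (2 ^ k - 1)]. *)
Lemma sifted_window (ps : seq nat) X : uniq ps -> all prime ps ->
  exists2 y, (X <= y < X + 2 * 4 ^ size ps)%N & sifted ps y.
Proof.
move=> ups pps; set k := size ps.
have prod_ge : 2^-1 ^+ k <= \prod_(p <- ps) (1 - p%:R^-1) :> rat.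
  rewrite {}/k; elim: (ps) pps => [|p l IH] /=; first by rewrite big_nil expr0.
  move=> /andP[pp pl]; rewrite big_cons exprS; apply: ler_pM; rewrite ?exprn_ge0 ?IH//.
  have : p%:R^-1 <= 2^-1 :> rat by rewrite lef_pV2 ?posrE ?ltr0n ?ler_nat ?prime_gt1 ?prime_gt0.
  by lra.
have := sifted_count_approx rat X ups pps.
have := sifted_count_approx rat (X + 2 * 4 ^ k)%N ups pps.
rewrite -/k; set P := \prod_(_ <- _) _ in prod_ge *.
have [has_sifted _ _|none] := boolP (has (sifted ps) (iota X (2 * 4 ^ k))).
  have /hasP[y] := has_sifted; rewrite mem_iota => yI ys.
  by exists y.
(* Without a survivor in the window the two counts coincide, and the two error bounds contradict
   [prod_ge]. *)
rewrite {1}/sifted_count iotaD count_cat add0n -/(sifted_count ps X).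
move: none; rewrite has_count -eqn0Ngt => /eqP ->.
rewrite addn0 [(X + _)%:R]natrD [(_ + _) * P]mulrDl.
rewrite !ler_norml => /andP[h1 h2] /andP[h3 h4].
have : 2 ^+ k * 2 <= (2 * 4 ^ k)%:R * P :> rat.
  rewrite natrM natrX (_ : 4%:R = 2 * 2 :> rat); last by ring.
  apply: le_trans (ler_wpM2l _ prod_ge); last by rewrite mulr_ge0// exprn_ge0.
  rewrite exprMn exprVn; set t := 2 ^+ k; have t0 : t != 0 by rewrite expf_neq0.
  by rewrite mulrA mulfK// mulrC.
by move: h1 h2 h3 h4; clear; clearbody P; move: (2 ^+ k) (_%:R * P) (_%:R * P) => x y z; lra.
Qed.

Lemma coprime_window (q X : nat) : (0 < q)%N ->
  exists2 y, (X <= y < X + 2 * 4 ^ size (primes q))%N & coprime y q.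
Proof.
move=> q0; have [|y yI ys] := sifted_window X (primes_uniq q).
  by apply/allP => p; rewrite mem_primes => /and3P[].
(* The number 0 survives only if [q] has no prime factor, that is, [q = 1]. *)
exists y => //; have [y0|y0] := posnP y.
  rewrite y0 /coprime gcd0n; apply/eqP/esym/eqP; rewrite eqn_leq q0 /=.
  rewrite leqNgt; apply/negP => q1; have pq := pdiv_prime q1.
  move/allP: ys => /(_ (pdiv q)); rewrite mem_primes pq q0 pdiv_dvd y0 dvdn0.
  by move/(_ isT).
rewrite coprime_has_primes//; apply/hasPn => p pq.
by move/allP: ys => /(_ p pq) npy; rewrite /= mem_primes negb_and negb_and npy !orbT.
Qed.
End Sieve.

(** * Simultaneous Dirichlet approximation on a grid, with denominators bounded below *)

Section Dirichlet.
Local Open Scope nat_scope.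

(* When [2 * T <= L]: [t * g] is at distance less than [T] from [(t * g + T) %/ L * L]. *)
Definition near_multiple (T L t g : nat) : bool := 0 < (t * g + T) %% L < 2 * T.

Lemma near_multipleP T L t g s : 2 * T <= L ->
  s * L < t * g + T < s * L + 2 * T -> near_multiple T L t g.
Proof.
move=> TL /andP[h1 h2]; rewrite /near_multiple.
have -> : t * g + T = s * L + (t * g + T - s * L) by lia.
by rewrite modnMDl modn_small; lia.
Qed.

(** The quotient of [t * g + T] by [L], with the quotient of the remainder by [t], locates
    [t * g + T] up to less than [t] and so determines [g]. The first takes at most [2 * t * Z]
    values and, the remainder being below [2 * T], the second at most [3 * T / t]. *)
Lemma card_near_multiple T L Z t : 0 < t -> t <= T -> 0 < Z -> T <= L ->
  #|[set g : 'I_(Z * L) | near_multiple T L t g]| <= 6 * T * Z.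
Proof.
move=> t0 tT Z0 TL; have L0 : 0 < L by exact: leq_trans (leq_trans t0 tT) TL.
pose f (g : 'I_(Z * L)) : 'I_(t * Z).+1 * 'I_((2 * T) %/ t).+1 :=
  (inord ((t * g + T) %/ L), inord ((t * g + T) %% L %/ t)).
set A := [set g | _].
have f_inj : {in A &, injective f}.
  move=> g g'; rewrite !inE => /andP[_ h] /andP[_ h'] [e1 e2].
  have quo_lt (x : 'I_(Z * L)) : (t * x + T) %/ L < (t * Z).+1.
    by rewrite ltn_divLR//; have := ltn_ord x; nia.
  have rem_lt x : x %% L < 2 * T -> (x %% L) %/ t < ((2 * T) %/ t).+1.
    by move=> xT; rewrite ltnS leq_div2r// ltnW.
  move/(congr1 val): e1 => /=; rewrite !inordK// => e1.
  move/(congr1 val): e2 => /=; rewrite !inordK ?rem_lt// => e2.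
  have E1 := divn_eq (t * g + T) L; have E1' := divn_eq (t * g' + T) L.
  have E2 := divn_eq ((t * g + T) %% L) t; have E2' := divn_eq ((t * g' + T) %% L) t.
  have := ltn_pmod ((t * g + T) %% L) t0; have := ltn_pmod ((t * g' + T) %% L) t0.
  rewrite e1 in E1; rewrite e2 in E2.
  move: (_ %/ L * L) E1 E1' => u E1 E1'; move: (_ %/ t * t) E2 E2' => v E2 E2' r1 r2.
  have {E1 E1' E2 E2'} E : t * g + ((t * g' + T) %% L) %% t = t * g' + ((t * g + T) %% L) %% t.
    by lia.
  by apply/val_inj => /=; move: (nat_of_ord g) (nat_of_ord g') (_ %% t) (_ %% t) E r1 r2; nia.
rewrite -(card_in_imset f_inj); apply: (leq_trans (max_card _)).
rewrite card_prod !card_ord.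
have h1 : (t * Z).+1 <= 2 * (t * Z) by nia.
have h2 : t * ((2 * T) %/ t).+1 <= 3 * T by have := leq_trunc_div (2 * T) t; nia.
by apply: (leq_trans (leq_mul h1 (leqnn _))); nia.
Qed.

(** Pigeonhole: the [H ^ m + 1] multipliers from 0 to [H ^ m] fall into [H ^ m] classes, according
    to which of the [H] intervals of length [T] modulo [H * T] contains each multiple of [g j]. The
    difference of two multipliers in one class serves as [t]. *)
Lemma simultaneous_approx (m H T : nat) (g : 'I_m -> nat) : 1 < H -> 0 < T ->
  exists2 t, 0 < t <= H ^ m & forall j, near_multiple T (H * T) t (g j).
Proof.
move=> H1 T0; have L0 : 0 < H * T by nia.
pose f (t : 'I_(H ^ m).+1) : {ffun 'I_m -> 'I_H} :=
  [ffun j => Ordinal (ltn_pmod ((t * g j) %% (H * T) %/ T) (ltnW H1))].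
have /injectivePn[t1 [t2 t12 ft]] : ~~ injectiveb f.
  apply/negP => /injectiveP/leq_card; rewrite card_ffun !card_ord.
  by rewrite ltnn.
wlog lt12 : t1 t2 t12 ft / t1 < t2.
  move=> W; have := t12; rewrite -val_eqE neq_ltn => /orP[|] lt12; first exact: (W t1 t2).
  by apply: (W t2 t1); rewrite // eq_sym.
exists (t2 - t1); first by have := ltn_ord t2; lia.
move=> j; have /(congr1 val) := congr1 (fun h : {ffun 'I_m -> 'I_H} => h j) ft; rewrite !ffunE /=.
set a := t1 * g j; set b := t2 * g j.
have ab : a <= b by rewrite leq_mul2r (ltnW lt12) orbT.
have modH x : (x %% (H * T)) %/ T < H by rewrite ltn_divLR// ltn_pmod.
rewrite !(modn_small (modH _)) => E.
have La := divn_eq a (H * T); have Lb := divn_eq b (H * T).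
have Ea := divn_eq (a %% (H * T)) T; have Eb := divn_eq (b %% (H * T)) T.
have ma := ltn_pmod (a %% (H * T)) T0; have mb := ltn_pmod (b %% (H * T)) T0.
have dab : a %/ (H * T) <= b %/ (H * T) by apply: leq_div2r.
apply: (@near_multipleP _ _ _ _ (b %/ (H * T) - a %/ (H * T))); first by nia.
rewrite !mulnBl -/a -/b; rewrite E in Ea.
have := leq_mul dab (leqnn (H * T)).
move: (_ * (H * T)) (_ * (H * T)) La Lb => u v La Lb uv.
by lia.
Qed.

(** A point with no approximation by [t >= T] has one with [0 < t < T]. Each such [t] serves at most
    [6 * T * Z] values per coordinate, so there are at most [T * (6 * T * Z) ^ m] bad points, at
    most half of the grid by the last hypothesis. *)
Lemma card_good (m H T Z : nat) : 1 < H -> 0 < T -> 0 < Z -> 2 * 6 ^ m * T <= H ^ m ->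
  (Z * (H * T)) ^ m <= 2 * #|[set g : {ffun 'I_m -> 'I_(Z * (H * T))} |
     [exists t : 'I_(H ^ m).+1, (T <= t) && [forall j, near_multiple T (H * T) t (g j)]]]|.
Proof.
move=> H1 T0 Z0 small; set N := Z * (H * T); set A := [set g | _].
have := cardsC A; rewrite card_ffun !card_ord => <-.
suff : 2 * #|~: A| <= N ^ m.
  have := cardsC A; rewrite card_ffun !card_ord => <-; lia.
pose B (t : nat) := [set g : {ffun 'I_m -> 'I_N} | [forall j, near_multiple T (H * T) t (g j)]].
have sub : ~: A \subset \bigcup_(t < T | 0 < t) B t.
  apply/fintype.subsetP => g; rewrite !inE => /existsPn bad.
  have [t /andP[t0 tH] gt] := simultaneous_approx (fun j => g j) H1 T0.
  have := bad (Ordinal (tH : t < (H ^ m).+1)); rewrite negb_and -ltnNge /= => /orP[tT|]; last first.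
    by case/negP; apply/forallP.
  apply/finset.bigcupP; exists (Ordinal tT) => //; rewrite inE; exact/forallP.
have cardB (t : 'I_T) : 0 < t -> #|B t| <= (6 * T * Z) ^ m.
  move=> t0; pose C := [set g : 'I_N | near_multiple T (H * T) t g].
  have -> : #|B t| = #|ffun_on (mem C) : {pred {ffun 'I_m -> 'I_N}}|.
    apply: eq_card => g; rewrite !inE; by apply/forallP/ffun_onP => h j; have := h j; rewrite inE.
  rewrite card_ffun_on card_ord.
  have cardC : #|C| <= 6 * T * Z by apply: card_near_multiple; rewrite ?(ltnW (ltn_ord t))//; nia.
  suff pow_le e : #|C| ^ e <= (6 * T * Z) ^ e by exact: pow_le.
  by have [->|e0] := posnP e; rewrite ?expn0// leq_exp2r.
have : #|~: A| <= T * (6 * T * Z) ^ m.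
  apply: (leq_trans (subset_leq_card sub)).
  have /leq_trans : #|\bigcup_(t < T | 0 < t) B t| <= \sum_(t < T | 0 < t) (6 * T * Z) ^ m.
    apply: (big_rec2 (fun (x : {set _}) y => #|x| <= y)); first by rewrite cards0.
    move=> t y x t0 xy; apply: (leq_trans (leq_card_setU _ _).1).
    by rewrite leq_add// cardB.
  apply; rewrite sum_nat_const leq_mul2r.
  by apply/orP; right; apply: leq_trans (max_card _) _; rewrite card_ord.
move=> h; apply: (@leq_trans (2 * 6 ^ m * T * (T * Z) ^ m)).
  by rewrite -!mulnA leq_mul2l /= mulnCA -expnMn mulnA.
apply: (leq_trans (leq_mul small (leqnn _))).
by rewrite -expnMn /N (_ : H * (T * Z) = Z * (H * T)) //; lia.
Qed.
End Dirichlet.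

Local Open Scope classical_set_scope.
Local Open Scope ring_scope.

(** * Growth of powers of [Rk k], and the length of the sieve window *)

Section Asymptotics.
Variable R : realType.
Implicit Types (x y e : R) (k : nat).

Lemma Rk_gt0 k : 0 < Rk k :> R. Proof. by rewrite /Rk exprn_gt0. Qed.

Lemma Rk_ge1 k : 1 <= Rk k :> R. Proof. by rewrite /Rk exprn_ege1// ler1n. Qed.

Lemma ltr_Rk k : k%:R < Rk k :> R.
Proof. by rewrite /Rk -natrX ltr_nat ltn_expl. Qed.

Lemma Rk_powRD k x y : Rk k `^ (x + y) = Rk k `^ x * Rk k `^ y :> R.
Proof. by rewrite powRD// (gt_eqF (Rk_gt0 k)) implybT. Qed.

Lemma Rk_powR_small x e : x < 0 -> 0 < e ->
  exists K, forall k, (K <= k)%N -> Rk k `^ x <= e.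
Proof.
move=> x0 e0; exists (Num.truncn (e `^ x^-1)).+1 => k Kk.
have ye : e `^ x^-1 <= Rk k.
  by rewrite (le_trans (ltW (truncnS_gt _)))// (le_trans _ (ltW (ltr_Rk k)))// ler_nat.
rewrite -[x]opprK powRN -[leRHS]invrK lef_pV2 ?posrE ?invr_gt0// ?powR_gt0 ?Rk_gt0//.
have -> : e^-1 = (e `^ x^-1) `^ (- x).
  by rewrite -powRrM mulrN mulVf ?lt_eqF// powR_inv1 ?ltW.
by apply: ge0_ler_powR; rewrite ?oppr_ge0 ?nnegrE ?powR_ge0 ?(ltW x0) ?(ltW (Rk_gt0 _)).
Qed.

Lemma Rk_powR_large x e : 0 < x -> exists K, forall k, (K <= k)%N -> e <= Rk k `^ x.
Proof.
move=> x0; have [e0|e0] := leP e 0; first by exists 0%N => k _; rewrite (le_trans e0) ?powR_ge0.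
have [||K hK] := @Rk_powR_small (- x) e^-1; rewrite ?oppr_lt0 ?invr_gt0//.
by exists K => k /hK; rewrite powRN lef_pV2 ?posrE// powR_gt0// Rk_gt0.
Qed.

(** A prime with [4 <= p ^ e] pays for its own factor 4 out of [q ^ e]; at most [K] primes are
    smaller, and their factors go into the constant. *)
Lemma coprime_window_powR e : 0 < e -> exists2 C : R, 1 <= C &
  forall q, (0 < q)%N -> (2 * 4 ^ size (primes q))%:R <= C * q%:R `^ e.
Proof.
move=> e0; pose K := (Num.truncn ((4 : R) `^ e^-1)).+1.
have large p : (K <= p)%N -> 4 <= p%:R `^ e :> R.
  move=> Kp; have -> : 4 = (4 `^ e^-1) `^ e :> R by rewrite -powRrM mulVf ?gt_eqF// powRr1.
  apply: ge0_ler_powR; rewrite ?nnegrE ?powR_ge0 ?(ltW e0)//.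
  by rewrite (le_trans (ltW (truncnS_gt _)))// ler_nat.
exists (2 * 4 ^+ K); first by rewrite -natrX -natrM ler1n muln_gt0 expn_gt0.
move=> q q0; rewrite natrM natrX -mulrA ler_pM2l//.
have few : (count (fun p => p < K)%N (primes q) <= K)%N.
  rewrite -size_filter -[leqRHS](size_iota 0); apply: uniq_leq_size.
    by rewrite filter_uniq// primes_uniq.
  by move=> p; rewrite mem_filter mem_iota add0n => /andP[].
(* The radical of [q] may replace [q], and [p ^ e] is then multiplicative over the list of
   primes. *)
have radical_le : (\prod_(p <- primes q) p <= q)%N.
  rewrite [leqRHS](prod_prime_decomp q0) /primes /unzip1 big_map.
  rewrite big_seq [leqRHS]big_seq; apply: leq_prod => -[p i] /=.
  by case/mem_prime_decomp => pp i0 _; rewrite -{1}(expn1 p) leq_pexp2l// prime_gt0.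
have all_pos : all (fun p => 0 < p)%N (primes q).
  by apply/allP => p; rewrite mem_primes => /and3P[/prime_gt0].
apply: (@le_trans _ _ (4 ^+ K * (\prod_(p <- primes q) p)%:R `^ e)); last first.
  by rewrite ler_pM2l ?exprn_gt0//; apply: ge0_ler_powR; rewrite ?nnegrE ?ler_nat// ltW.
apply: (@le_trans _ _ (4 ^+ count (fun p => p < K)%N (primes q)
                       * (\prod_(p <- primes q) p)%:R `^ e)); last first.
  by rewrite ler_wpM2r ?powR_ge0// ler_weXn2l// ler1n.
elim: (primes q) all_pos => [|p s IH] /=; first by rewrite big_nil powR1 mulr1.
move=> /andP[p0 s0]; rewrite big_cons natrM powRM// exprS exprD mulrACA.
apply: ler_pM; rewrite ?exprn_ge0 ?IH//.
have [pK|Kp] := ltnP p K; last by rewrite expr0 mul1r large.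
rewrite expr1 ler_peMr//; apply: (@le_trans _ _ (1 `^ e)); first by rewrite powR1.
by apply: ge0_ler_powR; rewrite ?nnegrE ?ler1n ?(ltW e0).
Qed.

End Asymptotics.

(** * Exponent identities for [Q] and [D] *)

Section Exponents.
Variables (R : realType) (m : nat) (a : R).
Hypotheses (m_gt0 : (0 < m)%N) (a_gt : 3 / 4 < a) (a_le1 : a <= 1).
Local Notation rho := (@Rk R).
Local Notation D := (Dk m.+1 a (1 / 2)).
Local Notation Q := (Qk m.+1 a (1 / 2)).

Let m_ge1 : 1 <= m%:R :> R. Proof. by rewrite ler1n. Qed.
Let mS : m.+1%:R = m%:R + 1 :> R. Proof. by rewrite -addn1 natrD. Qed.

(** The exponent of [Q] as a power of [Rk k], for [b = 1 / 2]. *)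
Definition kappa : R := (m.+1%:R - 1) / (m.+1%:R + 1) * (2 * a - 1 / 2 - 1).

(** The bound [3 / 4 < a] amounts to positivity of the second factor; it makes [Q] tend to
    infinity. *)
Lemma kappa_gt0 : 0 < kappa.
Proof.
have m1 := m_ge1; have ha := a_gt; rewrite /kappa mS mulr_gt0 ?divr_gt0//; lra. Qed.

Lemma kappa_le1 : kappa <= 1.
Proof.
have m1 := m_ge1; have ha := a_gt; have ha' := a_le1.
rewrite /kappa mS mulrAC ler_pdivrMr; last by lra.
rewrite mul1r; have : (m%:R + 1 - 1) * (2 * a - 1 / 2 - 1) <= (m%:R + 1 - 1) * 1.
  by rewrite ler_pM2l; lra.
by lra.
Qed.

(** The [m]-th root of [Q]: with about [vk k] intervals per coordinate, the pigeonhole yields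
    denominators up to about [Q]. *)
Definition vk k : R := rho k `^ (kappa / m%:R).

Lemma vk_expm k : vk k ^+ m = Q k.
Proof.
rewrite /vk /Qk -powR_mulrn ?powR_ge0// -powRrM; congr (_ `^ _).
by rewrite -/kappa divfK// pnatr_eq0 -lt0n.
Qed.

(** The transversal mesh is [1 / (D * L)], where [L] is an interval count of order [vk] times a
    denominator bound of order [Q]; this identity makes it comparable to [R ^ (- a)]. *)
Lemma vk_expS k : vk k ^+ m.+1 * D k = rho k `^ a.
Proof.
rewrite /vk /Dk -powR_mulrn ?powR_ge0// -powRrM -Rk_powRD; congr (_ `^ _).
have m1 := m_ge1; have ha := a_gt; have ha' := a_le1.
rewrite /kappa mS; field; rewrite !gt_eqF//; lra.
Qed.

(** Hence first coordinates [2 p_1 R / (q D ^ 2)] with [q] about [Q] are spaced by about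
    [R ^ (- 1 / 2)], the order of the long side of a slab. *)
Lemma Q_mul_D2 k : Q k * D k ^+ 2 = rho k * rho k `^ (1 / 2).
Proof.
rewrite -[X in _ = X * _](powRr1 (ltW (Rk_gt0 R k))) /Qk /Dk.
rewrite -powR_mulrn ?powR_ge0// -powRrM -!Rk_powRD.
congr (_ `^ _); have m1 := m_ge1; have ha := a_gt; have ha' := a_le1.
rewrite mS; field; rewrite !gt_eqF//; lra.
Qed.

Lemma D_gt0 k : 0 < D k. Proof. by rewrite powR_gt0// Rk_gt0. Qed.

Lemma Q_le_rho k : Q k <= rho k.
Proof. by rewrite -[leRHS](powRr1 (ltW (Rk_gt0 R k))) /Qk ler_powR ?Rk_ge1// kappa_le1. Qed.

Lemma D_large e : exists K, forall k, (K <= k)%N -> e <= D k.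
Proof.
apply: Rk_powR_large; have m1 := m_ge1; have ha := a_gt; have ha' := a_le1.
rewrite mS divr_gt0//.
have : (m%:R + 1 - 1) * a <= (m%:R + 1 - 1) * 1 by rewrite ler_pM2l; lra.
by lra.
Qed.

(** The grid will have [H = 12 * u] and [T = u ^ m]: then [24 * u <= vk] gives [2 * H ^ m <= Q], and
    the 12 gives [2 * 6 ^ m * T <= H ^ m]. Truncating [vk / 24 >= 1] loses at most a factor 2, hence
    the 48. *)
Lemma mesh_exists : exists K, forall k, (K <= k)%N -> exists u : nat, (0 < u)%N /\
  (24 * u)%:R <= vk k <= (48 * u)%:R.
Proof.
have k0 : 0 < kappa / m%:R by rewrite divr_gt0 ?kappa_gt0 ?ltr0n.
have [K hK] := Rk_powR_large 24 k0; exists K => k /hK.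
rewrite -/(vk k) => v24.
have u1 : 1 <= vk k / 24 by lra.
exists (Num.truncn (vk k / 24)); rewrite truncn_gt0; split=> //.
have /andP[h1 h2] := Num.Theory.truncn_itv (le_trans ler01 u1).
have h3 : 1 <= (Num.truncn (vk k / 24))%:R :> R by rewrite ler1n truncn_gt0.
rewrite -[X in _ < X]natr1 in h2; rewrite !natrM; apply/andP.
set t := (Num.truncn _)%:R in h1 h2 h3 *; clearbody t; split; lra.
Qed.

End Exponents.

(** * Slabs of level k inside a box *)

Section Boxes.
Variables (R : realType) (m : nat).
Implicit Types (b x : 'I_m.+1 -> R).

Definition side (l0 l1 : R) (i : 'I_m.+1) : R := if (i : nat) == 0%N then l0 else l1.

Definition box b (l0 l1 : R) : set ('I_m.+1 -> R) :=
  [set x | forall i, b i <= x i <= b i + side l0 l1 i].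

Definition slab_corner (a c : R) k (p : nat -> int) q (i : 'I_m.+1) : R :=
  slab_center m.+1 a (1 / 2) k p q i - side (c * Rk k `^ (- (1 / 2))) (c * (Rk k)^-1) i / 2.

Lemma slab_box (a c : R) k p q :
  slab m.+1 a (1 / 2) c k p q =
  box (slab_corner a c k p q) (c * Rk k `^ (- (1 / 2))) (c * (Rk k)^-1).
Proof.
rewrite /slab /box /slab_corner /side; apply/seteqP; split => x /= + i => /(_ i);
  rewrite ler_norml; case: ifP => _; move: (slab_center _ _ _ _ _ _ _) (c * _) => y z;
  by move=> /andP[h1 h2]; apply/andP; split; lra.
Qed.

Lemma side_ord0 (l0 l1 : R) : side l0 l1 ord0 = l0. Proof. by []. Qed.

Lemma side_lift (l0 l1 : R) (j : 'I_m) : side l0 l1 (lift ord0 j) = l1. Proof. by []. Qed.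

End Boxes.

Section Children.
Variables (R : realType) (m : nat) (a : R).
Hypotheses (m_gt0 : (0 < m)%N) (a_gt : 3 / 4 < a) (a_le1 : a <= 1).
Local Notation rho := (@Rk R).
Local Notation D := (Dk m.+1 a (1 / 2)).
Local Notation Q := (Qk m.+1 a (1 / 2)).

(** A sieve window of [J] numerators just above [y * q] contains one coprime to [q], and dividing by
    [q >= 2 * T] bounds its distance from [y]. The extra 1 accounts for rounding [y * q]. *)
Lemma coprime_in_cell (J T q : nat) (y : R) : 0 <= y -> (0 < T)%N -> (2 * T <= q)%N ->
  (2 * 4 ^ size (primes q) <= J)%N ->
  exists2 p : nat, coprime p q & y <= p%:R / q%:R <= y + (J%:R + 1) / (2 * T%:R).
Proof.
move=> y0 T0 Tq Jq; have q0 : (0 < q)%N by lia.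
have [p /andP[Xp pX] pq] := coprime_window (Num.truncn (y * q%:R)).+1 q0.
exists p => //; have qR0 : 0 < q%:R :> R by rewrite ltr0n.
have yq0 : 0 <= y * q%:R by rewrite mulr_ge0 ?ler0n.
have /andP[h1 h2] := Num.Theory.truncn_itv yq0.
apply/andP; split.
  by rewrite ler_pdivlMr// (le_trans (ltW h2))// ler_nat.
rewrite ler_pdivrMr// mulrDl.
have h3 : p%:R <= (Num.truncn (y * q%:R))%:R + J%:R :> R.
  by rewrite -natrD ler_nat -ltnS -addSn (leq_trans pX)// leq_add2l.
have h4 : J%:R + 1 <= (J%:R + 1) / (2 * T%:R) * q%:R :> R.
  rewrite mulrAC ler_pdivlMr ?mulr_gt0 ?ltr0n// ler_wpM2l ?addr_ge0 ?ler0n//.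
  by rewrite -natrM ler_nat.
by lra.
Qed.

Lemma near_multiple_approx (T L t g : nat) : (0 < t)%N -> (0 < L)%N -> (T <= t)%N ->
  near_multiple T L t g ->
  `|((t * g + T) %/ L)%:R / t%:R - g%:R / L%:R| <= L%:R^-1 :> R.
Proof.
move=> t0 L0 Tt /andP[h1 h2]; set s := ((t * g + T) %/ L)%N.
have E := divn_eq (t * g + T) L.
have t0R : 0 < t%:R :> R by rewrite ltr0n.
have L0R : 0 < L%:R :> R by rewrite ltr0n.
have -> : s%:R / t%:R - g%:R / L%:R = (s%:R * L%:R - t%:R * g%:R) / (t%:R * L%:R) :> R.
  by field; rewrite !gt_eqF.
rewrite normrM [X in _ * X]ger0_norm ?invr_ge0 ?mulr_ge0 ?ler0n//.
rewrite ler_pdivrMr ?mulr_gt0// mulrCA mulVf ?gt_eqF// mulr1 ler_norml.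
have hT : T%:R <= t%:R :> R by rewrite ler_nat.
have h3 : s%:R * L%:R <= t%:R * g%:R + T%:R :> R.
  by rewrite -!natrM -natrD ler_nat /s; clear -E h1 h2; lia.
have h4 : t%:R * g%:R <= s%:R * L%:R + T%:R :> R.
  by rewrite -!natrM -natrD ler_nat /s; clear -E h1 h2; lia.
by apply/andP; split; lra.
Qed.

Lemma mesh_bounds k (u : nat) : (0 < u)%N -> (24 * u)%:R <= vk m a k <= (48 * u)%:R ->
  [/\ (2 * (12 * u) ^ m)%:R <= Q k, (u ^ m)%:R <= Q k, Q k <= 48 ^+ m * (u ^ m)%:R,
      D k * (12 * u * u ^ m)%:R <= rho k `^ a &
      rho k `^ a <= 48 ^+ m.+1 * (D k * (12 * u * u ^ m)%:R)].
Proof.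
move=> u0 /andP[h1 h2]; have D0 := D_gt0 m a k.
have v0 : 0 <= vk m a k by rewrite powR_ge0.
have lo e : (24 * u)%:R ^+ e <= vk m a k ^+ e by rewrite lerXn2r ?nnegrE ?ler0n.
have hi e : vk m a k ^+ e <= (48 * u)%:R ^+ e by rewrite lerXn2r ?nnegrE ?ler0n.
have pow2 : (2 <= 2 ^ m)%N by rewrite -{1}(expn1 2) leq_pexp2l.
split.
- rewrite -vk_expm//; apply: le_trans (lo m); rewrite -natrX ler_nat.
  rewrite (_ : 24 * u = 2 * (12 * u))%N; last by lia.
  by rewrite [leqRHS]expnMn leq_mul2r pow2 orbT.
- rewrite -vk_expm//; apply: le_trans (lo m); rewrite -natrX ler_nat.
  by rewrite leq_exp2r//; lia.
- rewrite -vk_expm//; apply: le_trans (hi m) _.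
  by rewrite natrM exprMn natrX.
- rewrite -(vk_expS m_gt0 a_gt a_le1) mulrC ler_pM2r//; apply: le_trans (lo m.+1).
  by rewrite -natrX ler_nat expnS leq_mul ?leq_exp2r//; lia.
- rewrite -(vk_expS m_gt0 a_gt a_le1) (mulrC (D k)) mulrA ler_pM2r//; apply: le_trans (hi m.+1) _.
  rewrite natrM exprMn ler_wpM2l ?exprn_ge0// -natrX ler_nat expnS.
  by rewrite leq_mul2r; lia.
Qed.

Lemma rho_sqrt_inv k : rho k / (Q k * D k ^+ 2) = rho k `^ (- (1 / 2)).
Proof.
by rewrite (Q_mul_D2 m_gt0 a_gt a_le1) powRN invfM mulrA divff ?mul1r// gt_eqF ?Rk_gt0.
Qed.

Definition good_grid (N H T L : nat) (g : {ffun 'I_m -> 'I_N}) :=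
  [exists t : 'I_(H ^ m).+1, (T <= t)%N && [forall j, near_multiple T L t (g j)]].

Lemma good_gridP (N H T L : nat) : exists den : {ffun 'I_m -> 'I_N} -> nat,
  forall g, good_grid H T L g ->
    [/\ (T <= den g)%N, (den g <= H ^ m)%N & forall j, near_multiple T L (den g) (g j)].
Proof.
suff h (g : {ffun 'I_m -> 'I_N}) : exists t, good_grid H T L g ->
    [/\ (T <= t)%N, (t <= H ^ m)%N & forall j, near_multiple T L t (g j)].
  by have [den denP] := choice h; exists den.
have [/existsP[t /andP[h1 /forallP h2]]|] := boolP (good_grid H T L g); last by exists 0%N.
by exists t => _; split=> //; rewrite -ltnS.
Qed.

Lemma split_coord (T : Type) (x0 : T) (x1 : 'I_m -> T) :
  exists f : 'I_m.+1 -> T, f ord0 = x0 /\ forall j, f (lift ord0 j) = x1 j.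
Proof.
exists (fun i => if unlift ord0 i is Some j then x1 j else x0); rewrite unlift_none; split=> // j.
by rewrite liftK.
Qed.

(** The 2 leaves a margin inside the box; for [x >= 6], [x - 3 >= x / 2], so the loss is at most
    half. *)
Lemma truncn_sub2 (x : R) : 6 <= x -> exists2 N : nat, (0 < N)%N & x / 2 <= N%:R <= x - 2.
Proof.
move=> x6; have x2 : 0 <= x - 2 by lra.
have /andP[N1 N2] := Num.Theory.truncn_itv x2; exists (Num.truncn (x - 2)).
  by rewrite truncn_gt0; lra.
rewrite -[X in _ < X]natr1 in N2; move: (_%:R) N1 N2 => N N1 N2.
by apply/andP; split; lra.
Qed.

Lemma ler_half_add (x y : R) : x - 1 < y -> x + 2^-1 <= y + 3 / 2.
Proof. by move=> xy; lra. Qed.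

(** One transversal coordinate. The grid starts between [d / 2] and [3 * d / 2] above the corner and
    has length at most [Z * d], so [d / 2] remains at each end for the displacement [w] and half a
    slab. *)
Lemma slab_in_period (b l y z o g d w half Z : R) : 0 <= w -> 12 * w <= d ->
  b + 2^-1 * d <= o -> o <= b + 3 / 2 * d -> 0 <= g -> g <= Z * d -> (Z + 2) * d <= l ->
  half <= w -> `|z - y| <= half / 2 -> `|y - (o + g)| <= w -> b <= z <= b + l.
Proof.
move=> w0 wd o1 o2 g0 gZ Zl hw; rewrite !ler_norml => /andP[h1 h2] /andP[h3 h4].
by apply/andP; split; lra.
Qed.

Lemma slab_in_cells (b l y z o x w half : R) : o = b + w -> 0 <= x * w ->
  (x + 1) * w <= l - 2 * w -> half <= w -> `|z - y| <= half / 2 ->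
  o + x * w <= y <= o + (x + 1) * w -> b <= z <= b + l.
Proof.
move=> -> x0 xl hw; rewrite !ler_norml => /andP[h1 h2] /andP[h3 h4].
by apply/andP; split; lra.
Qed.

Lemma ler_cell_dist (y o x w : R) : 0 <= w -> o + x * w <= y <= o + (x + 1) * w ->
  `|y - (o + x * w)| <= w.
Proof. by move=> w0 /andP[h1 h2]; rewrite ler_norml; apply/andP; split; lra. Qed.

(** Slabs are indexed by a cell in the [x_1] direction and a transversal grid point having an
    approximation with denominator at least [T]. The factor [2 ^+ m.+2] collects a 2 per coordinate
    for the margins and one more for the discarded grid points. *)
Lemma children_at (c : R) b (l0 l1 : R) k (H T L J : nat) (w0 w1 : R) :
  0 < c -> c <= 1 -> 0 <= b ord0 ->
  (1 < H)%N -> (0 < T)%N -> L = (H * T)%N -> (12 <= L)%N -> (2 * 6 ^ m * T <= H ^ m)%N ->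
  (2 * H ^ m)%:R <= Q k ->
  (forall q, (0 < q)%N -> q%:R <= Q k -> (2 * 4 ^ size (primes q) <= J)%N) ->
  w0 = (J%:R + 1) * rho k / (T%:R * D k ^+ 2) -> w1 = (D k * L%:R)^-1 ->
  rho k `^ (- (1 / 2)) <= w0 -> (rho k)^-1 <= w1 -> 6 * w0 <= l0 -> 6 <= l1 * D k ->
  exists (I : finType) (A : {set I}) (org : 'I_m.+1 -> R) (G : I -> 'I_m.+1 -> nat)
    (p : I -> nat -> int) (q : I -> nat),
  [/\ l0 / w0 * (l1 / w1) ^+ m <= 2 ^+ m.+2 * #|A|%:R,
      injective G &
      forall x, x \in A -> [/\ admissible m.+1 (p x) (q x), (1 <= q x)%N, (q x)%:R <= Q k,
        slab m.+1 a (1 / 2) c k (p x) (q x) `<=` box b l0 l1 &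
        forall i, `|slab_center m.+1 a (1 / 2) k (p x) (q x) i
                    - (org i + (G x i)%:R * side w0 w1 i)| <= side w0 w1 i]].
Proof.
move=> c0 c1 b0 H1 T0 LE L0 small HQ hJ w0E w1E w0_ge w1_ge w0l l1D.
have D0 := D_gt0 m a k; have rho0 := Rk_gt0 R k.
have T0R : 0 < T%:R :> R by rewrite ltr0n.
have w0_gt0 : 0 < w0 by rewrite (lt_le_trans _ w0_ge)// powR_gt0.
have LR : 12 <= L%:R :> R by rewrite ler_nat.
have L0R : 0 < L%:R :> R by exact: lt_le_trans LR.
have w1_gt0 : 0 < w1 by rewrite (lt_le_trans _ w1_ge)// invr_gt0.
have l0w0 : 6 <= l0 / w0 by rewrite ler_pdivlMr.
have [M M0 /andP[M1 M2]] := truncn_sub2 l0w0.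
have [Z Z0 /andP[Z1 Z2]] := truncn_sub2 l1D.
have card_goodR := card_good H1 T0 Z0 small; rewrite -LE in card_goodR.
have [den denP] := good_gridP (Z * L) H T L.
(* The half period comes from [(t + 2 s_j) / (2 t) = 1 / 2 + s_j / t]; the ceiling moves the grid
   into the box by whole periods [1 / D], and the first coordinate starts one cell inside. *)
have [org [org0 orgj]] := split_coord (b ord0 + w0)
  (fun j => ((Num.ceil (b (lift ord0 j) * D k))%:~R + 2^-1) / D k).
have den_gt0 g : good_grid H T L g -> (0 < den g)%N.
  by case/denP => Tt _ _; exact: leq_trans T0 Tt.
have den_Q g : good_grid H T L g -> (2 * den g)%:R <= Q k.
  by case/denP => _ tH _; apply: le_trans HQ; rewrite ler_nat leq_mul2l.
have first_coord (x : 'I_M * {ffun 'I_m -> 'I_(Z * L)}) : exists p1 : nat, good_grid H T L x.2 ->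
    coprime p1 (2 * den x.2) /\
    org ord0 + x.1%:R * w0 <= 2 * p1%:R * rho k / ((2 * den x.2)%:R * D k ^+ 2)
      <= org ord0 + (x.1%:R + 1) * w0.
  have [gx|] := boolP (good_grid H T L x.2); last by exists 0%N.
  (* The left end of the cell, in the unit [2 * rho k / D k ^+ 2] in which the first coordinate of a
     centre is [p_1 / q]. It must be nonnegative because [p_1] is sought among the naturals. *)
  have y0 : 0 <= (org ord0 + x.1%:R * w0) * (D k ^+ 2 / (2 * rho k)).
    rewrite mulr_ge0// ?divr_ge0 ?exprn_ge0 ?mulr_ge0 ?(ltW D0) ?(ltW rho0)//.
    by rewrite org0 !addr_ge0 ?mulr_ge0 ?ler0n ?(ltW w0_gt0).
  have q2 : (0 < 2 * den x.2)%N by rewrite muln_gt0 den_gt0.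
  have T2 : (2 * T <= 2 * den x.2)%N by rewrite leq_mul2l; case: (denP _ gx).
  have [p1 p1q /andP[h1 h2]] := coprime_in_cell y0 T0 T2 (hJ _ q2 (den_Q _ gx)).
  exists p1 => _; split=> //.
  have f0 : 0 < 2 * rho k / D k ^+ 2 by rewrite divr_gt0 ?mulr_gt0 ?exprn_gt0.
  have -> : 2 * p1%:R * rho k / ((2 * den x.2)%:R * D k ^+ 2)
      = p1%:R / (2 * den x.2)%:R * (2 * rho k / D k ^+ 2).
    by field; rewrite (gt_eqF D0) pnatr_eq0 -lt0n den_gt0.
  have e1 : (org ord0 + x.1%:R * w0) * (D k ^+ 2 / (2 * rho k)) * (2 * rho k / D k ^+ 2)
      = org ord0 + x.1%:R * w0.
    by rewrite -mulrA [X in _ * X](_ : _ = 1) ?mulr1//; field; rewrite !gt_eqF.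
  have e2 : (J%:R + 1) / (2 * T%:R) * (2 * rho k / D k ^+ 2) = w0.
    by rewrite w0E; field; rewrite !gt_eqF.
  rewrite -{1}e1 ler_pM2r// h1 /=.
  rewrite (_ : org ord0 + (x.1%:R + 1) * w0 = ((org ord0 + x.1%:R * w0)
    * (D k ^+ 2 / (2 * rho k)) + (J%:R + 1) / (2 * T%:R)) * (2 * rho k / D k ^+ 2)).
    by rewrite ler_pM2r.
  by rewrite [RHS]mulrDl e1 e2 [_ * w0]mulrDl mul1r addrA.
have {first_coord} [p1 p1P] := choice first_coord.
pose E (j : 'I_m) := Num.ceil (b (lift ord0 j) * D k).
pose s (x : 'I_M * {ffun 'I_m -> 'I_(Z * L)}) j := ((den x.2 * x.2 j + T) %/ L)%N.
(* Modulo 2 this is [den x.2], half of the denominator, so the parity prescribed by [q] modulo 4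
   holds. The first term shifts the point by whole periods. *)
pose pj x j : int := (2 * den x.2)%N%:Z * E j + (den x.2)%:Z + 2 * (s x j)%:Z.
pose p x (i : nat) : int := if i is j.+1 then oapp (pj x) 0 (insub j) else (p1 x)%:Z.
pose q (x : 'I_M * {ffun 'I_m -> 'I_(Z * L)}) := (2 * den x.2)%N.
have [G GP] := choice (fun x : 'I_M * {ffun 'I_m -> 'I_(Z * L)} =>
  split_coord (x.1 : nat) (fun j => x.2 j : nat)).
have G0 x : G x ord0 = x.1 by case: (GP x).
have Gj x j : G x (lift ord0 j) = x.2 j by case: (GP x).
pose A := [set x : 'I_M * {ffun 'I_m -> 'I_(Z * L)} | good_grid H T L x.2]%SET.
have center0 x : x \in A -> org ord0 + x.1%:R * w0
    <= slab_center m.+1 a (1 / 2) k (p x) (q x) ord0 <= org ord0 + (x.1%:R + 1) * w0.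
  by rewrite inE => /p1P[_]; rewrite /slab_center /= -pmulrn.
have centerj x j : x \in A ->
    `|slab_center m.+1 a (1 / 2) k (p x) (q x) (lift ord0 j)
      - (org (lift ord0 j) + (x.2 j)%:R * w1)| <= w1.
  rewrite inE => gx; have [Tt tH /(_ j) nearj] := denP _ gx.
  have t0 := den_gt0 _ gx; have t0R : 0 < (den x.2)%:R :> R by rewrite ltr0n.
  have -> : slab_center m.+1 a (1 / 2) k (p x) (q x) (lift ord0 j)
     - (org (lift ord0 j) + (x.2 j)%:R * w1)
     = ((s x j)%:R / (den x.2)%:R - (x.2 j)%:R / L%:R) / D k.
    rewrite /slab_center lift0 /= valK /= /pj /q orgj -/(E j) w1E.
    rewrite !rmorphD !rmorphM /= -!pmulrn ?natrM.
    by field; rewrite !gt_eqF ?addr_gt0.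
  rewrite normrM [X in _ * X]ger0_norm ?invr_ge0 ?(ltW D0)// w1E invfM mulrC ler_pM2l ?invr_gt0//.
  by apply: near_multiple_approx nearj => //; rewrite (leq_trans _ L0).
pose B : {set {ffun 'I_m -> 'I_(Z * L)}} := [set g | good_grid H T L g]%SET.
have cardA : #|A| = (M * #|B|)%N.
  rewrite (_ : A = finset.setX [set: 'I_M]%SET B).
    by rewrite finset.cardsX finset.cardsT card_ord.
  by apply/finset.setP => -[i g]; rewrite !inE.
exists ('I_M * {ffun 'I_m -> 'I_(Z * L)})%type, A, org, G, p, q; split.
- have hM : l0 / w0 <= 2 * M%:R by rewrite [leRHS]mulrC -ler_pdivrMr.
  have hZ : l1 / w1 <= 2 * (Z * L)%:R.
    by rewrite w1E invrK natrM !mulrA ler_wpM2r ?ler0n// [2 * _]mulrC -ler_pdivrMr.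
  have l1w1 : 0 <= l1 / w1.
    by rewrite w1E invrK mulrA mulr_ge0 ?ler0n// (le_trans _ l1D).
  have hg : ((Z * L) ^ m)%:R <= 2 * #|B|%:R :> R by rewrite -natrM ler_nat.
  apply: (@le_trans _ _ (2 * M%:R * (2 * (Z * L)%:R) ^+ m)).
    apply: ler_pM => //; [exact: le_trans l0w0|exact: exprn_ge0|].
    by rewrite lerXn2r ?nnegrE// (le_trans l1w1).
  rewrite cardA (natrM _ M) exprMn -(natrX _ (Z * L)) !exprS.
  rewrite (_ : 2 * M%:R * (2 ^+ m * _) = 2 * 2 ^+ m * M%:R * ((Z * L) ^ m)%:R); last by ring.
  rewrite [leRHS](_ : _ = 2 * 2 ^+ m * M%:R * (2 * #|B|%:R)); last by ring.
  by rewrite ler_wpM2l// !mulr_ge0 ?exprn_ge0 ?ler0n.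
- move=> [i g] [i' g'] e; congr (_, _).
    by apply: val_inj; have := congr1 (@^~ ord0) e; rewrite !G0.
  by apply/ffunP => j; apply: val_inj; have := congr1 (@^~ (lift ord0 j)) e; rewrite !Gj.
move=> x xA; have gx : good_grid H T L x.2 by rewrite inE in xA.
have pjE j : (1 <= j < m.+1)%N -> exists j', p x j = pj x j'.
  case: j => // j /andP[_ jm]; exists (Ordinal (jm : (j < m)%N)).
  by rewrite /p (insubT (fun j => j < m)%N jm).
have pj_parity j : (2 %| pj x j)%Z = ~~ odd (den x.2).
  rewrite /pj PoszM -mulrA rpredDr ?dvdz_mulr// rpredDl ?dvdz_mulr//.
  by rewrite dvdzE /= dvdn2.
split.
- split.
  + by rewrite coprimezE /=; case: (p1P x gx).
  + move=> q4 j /pjE[j' ->]; rewrite pj_parity.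
    by move: q4; rewrite /q; move: (den x.2); clear => t; lia.
  + move=> q4 j /pjE[j' ->]; rewrite pj_parity.
    by move: q4; rewrite /q; move: (den x.2); clear => t; lia.
- by rewrite /q muln_gt0 den_gt0.
- exact: den_Q.
- have half0 : c * rho k `^ (- (1 / 2)) <= w0.
    by apply: le_trans w0_ge; rewrite ler_piMl ?powR_ge0.
  have half1 : c * (rho k)^-1 <= w1.
    by apply: le_trans w1_ge; rewrite ler_piMl ?invr_ge0 ?(ltW rho0).
  move=> z zs i; have := zs i; case: (unliftP ord0 i) => [j ->|->].
    rewrite side_lift lift0 /= => hz.
    have w12 : 12 * w1 <= (D k)^-1.
      by rewrite w1E invfM mulrCA ger_pMr ?invr_gt0// ler_pdivrMr ?mul1r// (lt_le_trans _ LR).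
    have ceil1 : b (lift ord0 j) + 2^-1 * (D k)^-1 <= org (lift ord0 j).
      rewrite orgj mulrDl lerD2r ler_pdivlMr//; exact: ceil_ge.
    have ceil2 : org (lift ord0 j) <= b (lift ord0 j) + 3 / 2 * (D k)^-1.
      rewrite orgj ler_pdivrMr// mulrDl mulfVK ?gt_eqF//.
      have := ceilB1_lt (b (lift ord0 j) * D k); rewrite -/(E j) rmorphB /=.
      exact: ler_half_add.
    have gw : (x.2 j)%:R * w1 <= Z%:R * (D k)^-1.
      rewrite w1E invfM mulrA mulrAC ler_pM2r ?invr_gt0//.
      by rewrite ler_pdivrMr ?(lt_le_trans _ LR)// -natrM ler_nat ltnW.
    have g0 : 0 <= (x.2 j)%:R * w1 by rewrite mulr_ge0 ?ler0n// ltW.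
    have Zl : (Z%:R + 2) * (D k)^-1 <= l1 by rewrite ler_pdivrMr// -lerBrDr.
    exact: slab_in_period (ltW w1_gt0) w12 ceil1 ceil2 g0 gw Zl half1 hz (centerj x j xA).
  rewrite side_ord0 /= => hz.
  have xM : (x.1%:R + 1) * w0 <= (l0 / w0 - 2) * w0.
    by rewrite ler_pM2r// (le_trans _ M2)// natr1 ler_nat.
  rewrite mulrBl divfK ?gt_eqF// in xM.
  have x0 : 0 <= x.1%:R * w0 by rewrite mulr_ge0 ?ler0n// ltW.
  exact: slab_in_cells org0 x0 xM half0 hz (center0 x xA).
move=> i; case: (unliftP ord0 i) => [j ->|->]; first by rewrite Gj side_lift; exact: centerj.
by rewrite G0 side_ord0; apply: ler_cell_dist (center0 x xA); exact: ltW.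
Qed.

(** [children_at] with [H = 12 * u], [T = u ^ m] and [J] of order [Q ^ e]. The constant absorbs
    [J + 1 <= 2 * B * R ^ e] and the comparison of [u] with [Q] up to powers of 48; the box only
    affects how large [k] must be. *)
Lemma children (c e : R) : 0 < c -> c <= 1 -> 0 < e -> e < 1 / 2 ->
  exists2 C : R, 0 < C & forall b l0 l1, 0 < l0 -> 0 < l1 -> 0 <= b ord0 ->
  exists K, forall k, (K <= k)%N -> exists (w0 w1 : R) (I : finType) (A : {set I})
    (org : 'I_m.+1 -> R) (G : I -> 'I_m.+1 -> nat) (p : I -> nat -> int) (q : I -> nat),
  [/\ rho k `^ (- (1 / 2)) <= w0 <= C * rho k `^ (e - 1 / 2),
      (rho k)^-1 <= w1 <= C * rho k `^ (- a),
      l0 / w0 * (l1 / w1) ^+ m <= 2 ^+ m.+2 * #|A|%:R,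
      injective G &
      forall x, x \in A -> [/\ admissible m.+1 (p x) (q x), (1 <= q x)%N, (q x)%:R <= Q k,
        slab m.+1 a (1 / 2) c k (p x) (q x) `<=` box b l0 l1 &
        forall i, `|slab_center m.+1 a (1 / 2) k (p x) (q x) i
                    - (org i + (G x i)%:R * side w0 w1 i)| <= side w0 w1 i]].
Proof.
move=> c0 c1 e0 e12; have [B B1 hB] := @coprime_window_powR R e e0.
exists (2 * B * 48 ^+ m.+1); first by rewrite !mulr_gt0 ?exprn_gt0 ?(lt_le_trans _ B1).
move=> b l0 l1 l00 l10 b0; set C := 2 * B * 48 ^+ m.+1.
have C0 : 0 < C by rewrite !mulr_gt0 ?exprn_gt0 ?(lt_le_trans _ B1).
have e12' : e - 1 / 2 < 0 by rewrite subr_lt0.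
have [K1 hK1] := mesh_exists m_gt0 a_gt.
have [K2 hK2] := Rk_powR_small e12' (divr_gt0 l00 (mulr_gt0 (ltr0n R 6) C0)).
have [K3 hK3] := D_large m_gt0 a_gt a_le1 (6 / l1).
exists (maxn K1 (maxn K2 K3)) => k; rewrite !geq_max => /and3P[/hK1[u [u0 hu]] /hK2 h2 /hK3 h3].
have [b2 b1 b3 b4 b5] := mesh_bounds u0 hu.
have D0 := D_gt0 m a k; have rho0 := Rk_gt0 R k; have Q0 : 0 < Q k by rewrite powR_gt0.
have T0 : (0 < u ^ m)%N by rewrite expn_gt0 u0.
have T0R : 0 < (u ^ m)%:R :> R by rewrite ltr0n.
have L12 : (12 <= 12 * u * u ^ m)%N by rewrite -mulnA leq_pmulr// muln_gt0 u0.
have L0R : 0 < (12 * u * u ^ m)%:R :> R by rewrite ltr0n (leq_trans _ L12).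
pose J := Num.truncn (B * Q k `^ e).
have BQ0 : 0 <= B * Q k `^ e by rewrite mulr_ge0 ?powR_ge0// (le_trans _ B1).
have J_le : J%:R + 1 <= 2 * B * rho k `^ e.
  have h : 1 <= rho k `^ e by rewrite -[leLHS](powRr0 (rho k)) ler_powR ?Rk_ge1 ?ltW.
  have h' : 1 <= B * rho k `^ e by rewrite mulr_ege1.
  have : J%:R <= B * rho k `^ e.
    apply: le_trans (_ : B * Q k `^ e <= _); first by rewrite truncn_le.
    rewrite ler_pM2l ?(lt_le_trans _ B1)//.
    by apply: ge0_ler_powR; rewrite ?nnegrE ?Q_le_rho// ltW.
  by rewrite -mulrA; lra.
have hJ q : (0 < q)%N -> q%:R <= Q k -> (2 * 4 ^ size (primes q) <= J)%N.
  move=> q0 qQ; rewrite truncn_ge_nat//; apply: le_trans (hB _ q0) _.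
  rewrite ler_pM2l ?(lt_le_trans _ B1)//.
  by apply: ge0_ler_powR; rewrite ?nnegrE ?ler0n// ltW.
pose w0 := (J%:R + 1) * rho k / ((u ^ m)%:R * D k ^+ 2).
pose w1 := (D k * (12 * u * u ^ m)%:R)^-1.
have w0_ge : rho k `^ (- (1 / 2)) <= w0.
  rewrite -rho_sqrt_inv /w0 -mulrA; apply: (@le_trans _ _ (rho k / ((u ^ m)%:R * D k ^+ 2))).
    by rewrite ler_pM2l// lef_pV2 ?posrE ?mulr_gt0 ?exprn_gt0// ler_pM2r ?exprn_gt0.
  rewrite ler_peMl ?lerDr ?ler0n// divr_ge0 ?(ltW rho0)// mulr_ge0 ?(ltW T0R)//.
  by rewrite exprn_ge0 ?(ltW D0).
have w0_le : w0 <= C * rho k `^ (e - 1 / 2).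
  rewrite Rk_powRD -rho_sqrt_inv mulrA /w0 -mulrA.
  have : rho k / ((u ^ m)%:R * D k ^+ 2) <= 48 ^+ m * (rho k / (Q k * D k ^+ 2)).
    rewrite [leRHS]mulrCA ler_pM2l// ler_pdivlMr ?mulr_gt0 ?exprn_gt0// mulrC.
    by rewrite ler_pdivrMr ?mulr_gt0 ?exprn_gt0// [leRHS]mulrA ler_pM2r ?exprn_gt0.
  move=> h; apply: le_trans (ler_pM _ _ J_le h) _.
  - by rewrite addr_ge0// ler0n.
  - by rewrite divr_ge0 ?(ltW rho0)// mulr_ge0 ?(ltW T0R) ?exprn_ge0 ?(ltW D0).
  rewrite [leRHS](_ : _ = 48 * (2 * B * rho k `^ e * (48 ^+ m * (rho k / (Q k * D k ^+ 2))))).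
    by rewrite ler_peMl ?ler1n// !mulr_ge0 ?exprn_ge0 ?invr_ge0 ?mulr_ge0 ?exprn_ge0 ?powR_ge0
      ?(ltW D0) ?(ltW rho0) ?(le_trans _ B1).
  by rewrite /C exprS; ring.
have w1_ge : (rho k)^-1 <= w1.
  rewrite lef_pV2 ?posrE ?mulr_gt0//; apply: le_trans b4 _.
  by rewrite -[leRHS](powRr1 (ltW rho0)) ler_powR ?Rk_ge1.
have w1_le : w1 <= C * rho k `^ (- a).
  rewrite powRN ler_pdivlMr ?powR_gt0// /w1 mulrC ler_pdivrMr ?mulr_gt0//.
  apply: le_trans b5 _; rewrite ler_pM2r ?mulr_gt0// /C ler_peMl ?exprn_ge0//.
  by rewrite mulr_ege1 ?ler1n.
have w0l : 6 * w0 <= l0.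
  move: h2; rewrite (ler_pdivlMr _ _ (mulr_gt0 (ltr0n R 6) C0)) ; apply: le_trans.
  by rewrite [leRHS]mulrCA ler_pM2l ?ltr0n// mulrC.
have l1D : 6 <= l1 * D k by rewrite mulrC -ler_pdivrMr.
have small : (2 * 6 ^ m * u ^ m <= (12 * u) ^ m)%N.
  rewrite (_ : 12 * u = 2 * 6 * u)%N; last by [].
  have pow2 : (2 ^ 1 <= 2 ^ m)%N by rewrite leq_pexp2l.
  by rewrite 2!expnMn leq_mul2r leq_mul2r pow2 !orbT.
have H1 : (1 < 12 * u)%N by rewrite (leq_trans _ (leq_pmulr 12 u0)).
have [I [A [org [G [p [q [hA hG hx]]]]]]] := children_at c0 c1 b0 H1 T0 erefl L12 small b2 hJ
  erefl erefl w0_ge w1_ge w0l l1D.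
by exists w0, w1, I, A, org, G, p, q; split; rewrite ?w0_ge ?w1_ge.
Qed.

End Children.

(** * Counting slabs that meet a small set *)

Section Counting.
Variables (R : realType) (m : nat).

Lemma bounded_gaps (I : finType) (S : {set I}) (f : I -> nat) (N : nat) :
  (forall x y, x \in S -> y \in S -> (f x <= f y + N)%N) ->
  exists mu, forall x, x \in S -> (mu <= f x <= mu + N)%N.
Proof.
move=> fN; have [->|[x0 x0S]] := set_0Vmem S; first by exists 0%N => x; rewrite inE.
have [x xS xmin] := arg_minnP f x0S.
by exists (f x) => y yS; rewrite fN// andbT xmin.
Qed.

(** Subtracting the least label in each direction embeds [S] into a product of ranges. *)
Lemma card_grid (I : finType) (S : {set I}) (G : I -> 'I_m.+1 -> nat) (N0 N1 : nat) :
  injective G ->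
  (forall x y, x \in S -> y \in S -> (G x ord0 <= G y ord0 + N0)%N) ->
  (forall j x y, x \in S -> y \in S -> (G x (lift ord0 j) <= G y (lift ord0 j) + N1)%N) ->
  (#|S| <= N0.+1 * N1.+1 ^ m)%N.
Proof.
move=> G_inj /bounded_gaps[mu0 h0] hj.
have [mu hmu] := choice (fun j => bounded_gaps (hj j)).
pose f x : 'I_N0.+1 * {ffun 'I_m -> 'I_N1.+1} :=
  (inord (G x ord0 - mu0), [ffun j => inord (G x (lift ord0 j) - mu j)]).
have f_inj : {in S &, injective f}.
  move=> x y xS yS [/(congr1 val) /= e0 /ffunP ej].
  have inE0 z : z \in S -> (inord (G z ord0 - mu0) : 'I_N0.+1) = (G z ord0 - mu0)%N :> nat.
    by move=> zS; have /andP[h1 h2] := h0 z zS; rewrite inordK// ltnS leq_subLR.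
  apply: G_inj; apply/funext => i; case: (unliftP ord0 i) => [j ->|->].
    have inEj z : z \in S ->
        (inord (G z (lift ord0 j) - mu j) : 'I_N1.+1) = (G z (lift ord0 j) - mu j)%N :> nat.
      by move=> zS; have /andP[h1 h2] := hmu j z zS; rewrite inordK// ltnS leq_subLR.
    have := congr1 (@nat_of_ord _) (ej j); rewrite !ffunE !inEj//.
    have /andP[h1 _] := hmu j x xS; have /andP[h2 _] := hmu j y yS => e.
    by rewrite -(subnK h1) -(subnK h2) e.
  rewrite !inE0// in e0; have /andP[h1 _] := h0 x xS; have /andP[h2 _] := h0 y yS.
  by rewrite -(subnK h1) -(subnK h2) e0.
rewrite -(card_in_imset f_inj); apply: leq_trans (max_card _) _.
by rewrite card_prod card_ffun !card_ord.
Qed.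

Lemma ler_grid_gap (g g' w X o y y' : R) : 0 < w -> `|y - (o + g * w)| <= w ->
  `|y' - (o + g' * w)| <= w -> `|y - y'| <= X + w -> g - g' <= X / w + 3.
Proof.
move=> w0; rewrite !ler_norml => /andP[h1 h2] /andP[h3 h4] /andP[h5 h6].
by rewrite -(ler_pM2r w0) [leRHS]mulrDl divfK ?gt_eqF// mulrBl; lra.
Qed.

Lemma ler_dist_min (b l y y' z z' r half w : R) : half <= w ->
  b <= z <= b + l -> b <= z' <= b + l -> `|z - z'| <= r ->
  `|z - y| <= half / 2 -> `|z' - y'| <= half / 2 -> `|y - y'| <= Num.min r l + w.
Proof.
move=> hw /andP[d1 d2] /andP[d3 d4].
rewrite !ler_norml => /andP[e1 e2] /andP[e3 e4] /andP[e5 e6].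
by have [rl|lr] := leP r l; apply/andP; split; lra.
Qed.

(** Centres of two slabs meeting [U] inside the box differ by at most [min r l + w] in each
    coordinate. Displacement from the grid adds [2 * w], so labels differ by at most
    [min r l / w + 3], and counting them adds 1. *)
Lemma meet_count (a c : R) k b (l0 l1 w0 w1 r : R) (I : finType) (A : {set I})
    (org : 'I_m.+1 -> R) (G : I -> 'I_m.+1 -> nat) (p : I -> nat -> int) (q : I -> nat)
    (U : set ('I_m.+1 -> R)) :
  0 < c -> c <= 1 -> 0 < r -> 0 < l0 -> 0 < l1 ->
  Rk k `^ (- (1 / 2)) <= w0 -> (Rk k)^-1 <= w1 -> injective G ->
  (forall x, x \in A -> slab m.+1 a (1 / 2) c k (p x) (q x) `<=` box b l0 l1 /\
        forall i, `|slab_center m.+1 a (1 / 2) k (p x) (q x) i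
                    - (org i + (G x i)%:R * side w0 w1 i)| <= side w0 w1 i) ->
  (forall x y, U x -> U y -> forall i, `|x i - y i| <= r) ->
  #|[set x in A | `[< U `&` slab m.+1 a (1 / 2) c k (p x) (q x) !=set0 >] ]%SET|%:R
    <= (Num.min r l0 / w0 + 4) * (Num.min r l1 / w1 + 4) ^+ m.
Proof.
move=> c0 c1 r0 l00 l10 w0_ge w1_ge G_inj hA hU; set S := [set x in A | _]%SET.
have rho0 := Rk_gt0 R k.
have w0_gt0 : 0 < w0 by rewrite (lt_le_trans _ w0_ge)// powR_gt0.
have w1_gt0 : 0 < w1 by rewrite (lt_le_trans _ w1_ge)// invr_gt0.
have half0 : c * Rk k `^ (- (1 / 2)) <= w0.
  by apply: le_trans w0_ge; rewrite ler_piMl ?powR_ge0.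
have half1 : c * (Rk k)^-1 <= w1.
  by apply: le_trans w1_ge; rewrite ler_piMl ?invr_ge0 ?(ltW rho0).
have dist x y i : x \in S -> y \in S ->
    `|slab_center m.+1 a (1 / 2) k (p x) (q x) i - slab_center m.+1 a (1 / 2) k (p y) (q y) i|
      <= Num.min r (side l0 l1 i) + side w0 w1 i.
  rewrite !inE => /andP[xA /asboolP[z [zU zx]]] /andP[yA /asboolP[z' [zU' zy]]].
  have [xbox _] := hA x xA; have [ybox _] := hA y yA.
  have hs : (if (i : nat) == 0%N then c * Rk k `^ (- (1 / 2)) else c * (Rk k)^-1) <= side w0 w1 i.
    by rewrite /side; case: ifP.
  exact: ler_dist_min hs (xbox _ zx i) (ybox _ zy i) (hU _ _ zU zU' i) (zx i) (zy i).
have gap i x y : x \in S -> y \in S ->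
    (G x i)%:R - (G y i)%:R <= Num.min r (side l0 l1 i) / side w0 w1 i + 3 :> R.
  move=> xS yS; have := dist x y i xS yS.
  have sw : 0 < side w0 w1 i by rewrite /side; case: ifP.
  have inA z : z \in S -> z \in A by rewrite inE => /andP[].
  have [_ /(_ i) h1] := hA x (inA x xS); have [_ /(_ i) h2] := hA y (inA y yS).
  exact: ler_grid_gap sw h1 h2.
pose N (l w : R) := Num.truncn (Num.min r l / w + 3).
have NP (l w : R) : 0 < l -> 0 < w -> (N l w)%:R <= Num.min r l / w + 3.
  by move=> l_gt0 w_gt0; rewrite truncn_le addr_ge0// divr_ge0 ?(ltW w_gt0)// le_min !ltW.
have gapN i x y : x \in S -> y \in S ->
    (G x i <= G y i + N (side l0 l1 i) (side w0 w1 i))%N.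
  move=> xS yS; have := gap i x y xS yS; have [le_xy _|lt_yx] := leqP (G x i) (G y i).
    exact: leq_trans le_xy (leq_addr _ _).
  rewrite -natrB ?(ltnW lt_yx)// -leq_subLR => h; rewrite /N truncn_ge_nat//.
  by rewrite (le_trans _ h)// ler0n.
have := @card_grid I S G (N l0 w0) (N l1 w1) G_inj (gapN ord0) (fun j => gapN (lift ord0 j)).
rewrite -(ler_nat R) natrM natrX => /le_trans; apply.
have e4 (l w : R) : 0 < l -> 0 < w -> (N l w).+1%:R <= Num.min r l / w + 4.
  move=> l_gt0 w_gt0; rewrite -natr1; have := NP l w l_gt0 w_gt0.
  by rewrite -[4]/(4%:R) (_ : 4%:R = 3 + 1 :> R) ?addrA ?lerD2r// -natr1.
apply: ler_pM; rewrite ?exprn_ge0 ?ler0n ?e4//.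
by rewrite lerXn2r ?nnegrE ?ler0n ?e4// (le_trans _ (e4 _ _ _ _)).
Qed.

End Counting.

(** * The gauge of a slab, and the inequality that drives one step of the descent *)

Section Gauge.
Variable R : realType.
Implicit Types (C s t r c : R) (m k : nat).

(* [t] stands for R = 2^k. The portion of a slab that a set of diameter [r] can occupy is
   r R^(1/2) for 1 / R <= r <= R^(-1/2); the factor (r R)^(s-1) replaces the smaller portion
   available at scales r <= 1 / R by what a measure of dimension s would give. *)
Definition gauge C s t r : R :=
  Num.min 1 (C * (r * t `^ (1 / 2)) * Num.min 1 ((r * t) `^ (s - 1))).

Lemma gauge_le1 C s t r : gauge C s t r <= 1.
Proof. by rewrite /gauge ge_min lexx. Qed.

Lemma gauge_ge0 C s t r : 0 <= C -> 0 <= r -> 0 <= gauge C s t r.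
Proof.
by move=> C0 r0; rewrite /gauge le_min ler01 !mulr_ge0 ?powR_ge0// le_min ler01 powR_ge0.
Qed.

Lemma gauge_le_lin C s t r : 0 <= C -> 0 <= r -> gauge C s t r <= C * (r * t `^ (1 / 2)).
Proof.
move=> C0 r0; rewrite /gauge ge_min; apply/orP; right.
by rewrite ler_piMr ?mulr_ge0 ?powR_ge0// ge_min lexx.
Qed.

Lemma gauge_le_pow C s k r : 0 <= C -> 0 < r ->
  gauge C s (Rk k) r <= C * (Rk k `^ (1 / 2) * Rk k `^ (s - 1) * r `^ s).
Proof.
move=> C0 r0; rewrite /gauge ge_min; apply/orP; right.
apply: le_trans (_ : C * (r * Rk k `^ (1 / 2)) * (r * Rk k) `^ (s - 1) <= _).
  by rewrite ler_wpM2l ?mulr_ge0 ?powR_ge0 ?(ltW r0)// ge_min lexx orbT.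
rewrite powRM ?(ltW r0) ?(ltW (Rk_gt0 _ _))// -mulrA ler_wpM2l//.
have -> : r `^ s = r * r `^ (s - 1).
  by rewrite -{2}(powRr1 (ltW r0)) -powRD ?(gt_eqF r0) ?implybT// addrC subrK.
by rewrite [leRHS](_ : _ = r * Rk k `^ (1 / 2) * (r `^ (s - 1) * Rk k `^ (s - 1)))//; ring.
Qed.

(** Since [t >= 1], [(r * t) ^ (s - 1)] is at least [r ^ (s - 1)]. This lower bound lets the gauge
    of a slab serve as [h] in the next step. *)
Lemma gauge_ge_pow C s t r : 0 <= C -> 1 <= t -> 1 <= s -> 0 < r -> r <= 1 ->
  Num.min 1 (C * t `^ (1 / 2)) * r `^ s <= gauge C s t r.
Proof.
move=> C0 t1 s1 r0 r1; have r01 : 0 < r <= 1 by rewrite r0.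
have rsE : r `^ s = r * r `^ (s - 1).
  by rewrite -{2}(powRr1 (ltW r0)) -powRD ?(gt_eqF r0) ?implybT// addrC subrK.
have rs1 : r `^ (s - 1) <= 1 by rewrite -[leRHS](powRr0 r) ger_powR// subr_ge0.
rewrite /gauge le_min; apply/andP; split.
  rewrite mulr_ile1 ?powR_ge0 ?le_min ?ler01 ?mulr_ge0 ?powR_ge0 ?ge_min ?lexx//.
  by rewrite -[leRHS](powRr0 r) ger_powR// (le_trans ler01).
rewrite rsE [leRHS](_ : _ = C * t `^ (1 / 2) * (r * Num.min 1 ((r * t) `^ (s - 1)))); last by ring.
have X0 : 0 <= C * t `^ (1 / 2) by rewrite mulr_ge0 ?powR_ge0.
apply: ler_pM.
- by rewrite le_min ler01.
- by rewrite mulr_ge0 ?powR_ge0// ltW.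
- by rewrite ge_min lexx orbT.
rewrite ler_pM2l// le_min rs1 /=; apply: ge0_ler_powR; rewrite ?subr_ge0 ?nnegrE ?(ltW r0)//.
  by rewrite mulr_ge0 ?(ltW r0)// (le_trans ler01).
by rewrite ler_peMr// ltW.
Qed.

(** The left side is the volume fraction of a slab that a set of diameter [r] can fill, up to [C0].
    With [x = r * R], the transversal part satisfies [min 1 x ^ m <= min 1 (x ^ (s - 1))] because
    [0 <= s - 1 <= m]. *)
Lemma gauge_slab m C0 c s k r : 0 <= C0 -> 0 < c -> c <= 1 -> 1 <= s -> s - 1 <= m%:R -> 0 < r ->
  Num.min 1 (C0 * (Num.min 1 (r / (c * Rk k `^ (- (1 / 2)))) *
                   Num.min 1 (r / (c * (Rk k)^-1)) ^+ m))
    <= gauge (C0 / c ^+ m.+1) s (Rk k) r.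
Proof.
move=> C00 c0 c1 s1 sm r0; have rho0 := Rk_gt0 R k.
rewrite /gauge le_min ge_min lexx /= ge_min; apply/orP; right.
rewrite -[in leRHS]mulrA -[in leRHS]mulrA ler_wpM2l//.
set x := r * Rk k; have x0 : 0 < x by rewrite mulr_gt0.
have min0 (y : R) : 0 <= y -> 0 <= Num.min 1 y by move=> y0; rewrite le_min ler01.
have -> : r / (c * (Rk k)^-1) = x / c by rewrite invfM invrK [_ * Rk k]mulrC mulrA.
have h1 : Num.min 1 (r / (c * Rk k `^ (- (1 / 2)))) <= r * Rk k `^ (1 / 2) / c.
  by rewrite ge_min powRN invfM invrK [c^-1 * _]mulrC mulrA lexx orbT.
have h2 : Num.min 1 (x / c) <= Num.min 1 x / c.
  have c1V : 1 <= c^-1 by rewrite invf_ge1.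
  rewrite ge_min; have [_|_] := leP 1 x; first by rewrite mul1r c1V.
  by rewrite lexx orbT.
have h3 : Num.min 1 x ^+ m <= Num.min 1 (x `^ (s - 1)).
  have [x1|x1] := leP 1 x.
    by rewrite expr1n le_min lexx /= -[leLHS](powRr0 x) ler_powR// subr_ge0.
  rewrite le_min exprn_ile1 ?(ltW x0) ?(ltW x1)//= -powR_mulrn ?(ltW x0)//.
  by rewrite ger_powR// x0 ltW.
apply: (@le_trans _ _ (r * Rk k `^ (1 / 2) / c * (Num.min 1 x / c) ^+ m)).
  have xc : 0 <= x / c by rewrite divr_ge0 ?(ltW x0) ?(ltW c0).
  apply: ler_pM => //.
  - by apply: min0; rewrite divr_ge0 ?mulr_ge0 ?powR_ge0 ?(ltW c0) ?(ltW r0).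
  - by rewrite exprn_ge0 ?min0.
  - by rewrite lerXn2r ?nnegrE ?min0// (le_trans (min0 _ xc)).
rewrite expr_div_n exprS invfM.
rewrite [leLHS](_ : _ = c^-1 / c ^+ m * (r * Rk k `^ (1 / 2) * Num.min 1 x ^+ m)); last by ring.
rewrite ler_wpM2l ?mulr_ge0 ?invr_ge0 ?exprn_ge0 ?(ltW c0)//.
by rewrite ler_wpM2l// mulr_ge0 ?powR_ge0// ltW.
Qed.

Lemma Rk_powR_mul_small (A x e : R) : x < 0 -> 0 <= A -> 0 < e ->
  exists K, forall k, (K <= k)%N -> A * Rk k `^ x <= e.
Proof.
move=> x0 A0 e0; have A1 : 0 < A + 1 by rewrite ltr_wpDl.
have [K hK] := Rk_powR_small x0 (divr_gt0 e0 A1); exists K => k /hK.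
rewrite ler_pdivlMr// mulrC; apply: le_trans.
by rewrite ler_wpM2r ?powR_ge0// lerDl.
Qed.

(** For [w1 <= r] the linear bound on the gauge is used and the surplus power [r ^ (m + 1 - s)] is
    bounded through [r < w0]; for [r < w1] the power bound is used, and the exponents add up to
    [e - 8 * e]. *)
Lemma fine_scale_bound m (a s C C1 B r w0 w1 e : R) k : e = (1 + m%:R * a - s) / 8 ->
  0 < C -> 0 < C1 -> 0 <= B -> 0 < r -> 0 < w0 -> 0 < w1 -> w1 <= w0 -> r < w0 ->
  w0 <= C * Rk k `^ (e - 1 / 2) -> w1 <= C * Rk k `^ (- a) -> s < 1 + m%:R * a -> a <= 1 ->
  B * w0 * (r + 4 * w1) ^+ m * gauge C1 s (Rk k) r <=
   Num.max (B * 5 ^+ m * C * C1 * C `^ (m.+1%:R - s) * Rk k `^ (e + (e - 1 / 2) * (m.+1%:R - s)))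
           (B * 5 ^+ m * C * C1 * C ^+ m * Rk k `^ (- (7 * e))) * r `^ s.
Proof.
move=> eE C0 C10 B0 r0 w00 w10 w10' rw0 w0C w1C sa a1; have rho0 := Rk_gt0 R k.
have g0 : 0 <= gauge C1 s (Rk k) r by rewrite gauge_ge0 ?ltW.
have rw_ge0 : 0 <= r + 4 * w1 by rewrite addr_ge0 ?mulr_ge0 ?(ltW r0) ?(ltW w10).
have Bw_ge0 : 0 <= B * w0 by rewrite mulr_ge0// ltW.
have [w1r|rw1] := leP w1 r.
  apply: (@le_trans _ _ (B * (C * Rk k `^ (e - 1 / 2)) * (5 * r) ^+ m *
                         (C1 * (r * Rk k `^ (1 / 2))))).
    apply: ler_pM => //; last by rewrite gauge_le_lin// ltW.
      by rewrite mulr_ge0 ?exprn_ge0.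
    apply: ler_pM; rewrite ?exprn_ge0 ?ler_wpM2l//.
    by rewrite lerXn2r ?nnegrE ?mulr_ge0 ?(ltW r0)//; lra.
  have rpow : r ^+ m.+1 <= r `^ s * (C `^ (m.+1%:R - s) * Rk k `^ ((e - 1 / 2) * (m.+1%:R - s))).
    rewrite -powR_mulrn ?(ltW r0)// -[m.+1%:R in leLHS](subrK s) addrC.
    rewrite powRD ?(gt_eqF r0) ?implybT//.
    rewrite ler_pM2l ?powR_gt0// powRrM -powRM ?powR_ge0 ?(ltW C0)//.
    have ms : 0 <= m.+1%:R - s.
      have : m%:R * a <= m%:R * 1 by rewrite ler_wpM2l ?ler0n.
      by rewrite -natr1; lra.
    apply: ge0_ler_powR; rewrite ?nnegrE ?mulr_ge0 ?powR_ge0 ?(ltW r0) ?(ltW C0)//.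
    by rewrite (le_trans (ltW rw0)).
  rewrite [leLHS](_ : _ = B * 5 ^+ m * C * C1 * (Rk k `^ (e - 1 / 2) * Rk k `^ (1 / 2))
                          * r ^+ m.+1); last first.
    by rewrite exprMn exprS; ring.
  rewrite -Rk_powRD subrK.
  apply: (@le_trans _ _ (B * 5 ^+ m * C * C1 * Rk k `^ e *
     (r `^ s * (C `^ (m.+1%:R - s) * Rk k `^ ((e - 1 / 2) * (m.+1%:R - s)))))).
    by rewrite ler_wpM2l// !mulr_ge0 ?exprn_ge0 ?powR_ge0 ?(ltW C0) ?(ltW C10).
  rewrite [leLHS](_ : _ = B * 5 ^+ m * C * C1 * C `^ (m.+1%:R - s) *
    (Rk k `^ e * Rk k `^ ((e - 1 / 2) * (m.+1%:R - s))) * r `^ s); last by ring.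
  by rewrite -Rk_powRD ler_wpM2r ?powR_ge0// le_max lexx.
apply: (@le_trans _ _ (B * (C * Rk k `^ (e - 1 / 2)) * (5 * (C * Rk k `^ (- a))) ^+ m *
    (C1 * (Rk k `^ (1 / 2) * Rk k `^ (s - 1) * r `^ s)))).
  apply: ler_pM => //; last by rewrite gauge_le_pow// ltW.
    by rewrite mulr_ge0 ?exprn_ge0.
  apply: ler_pM; rewrite ?exprn_ge0 ?ler_wpM2l//.
  by rewrite lerXn2r ?nnegrE ?mulr_ge0 ?powR_ge0 ?(ltW C0)//; lra.
rewrite [leLHS](_ : _ = B * 5 ^+ m * C * C1 * C ^+ m * (Rk k `^ (e - 1 / 2) * (Rk k `^ (- a)) ^+ m
   * Rk k `^ (1 / 2) * Rk k `^ (s - 1)) * r `^ s); last by rewrite !exprMn; ring.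
rewrite -[(Rk k `^ (- a)) ^+ m]powR_mulrn ?powR_ge0// -powRrM -!Rk_powRD.
rewrite (_ : e - 1 / 2 + - a * m%:R + 1 / 2 + (s - 1) = - (7 * e)); last by rewrite eE; field.
by rewrite ler_wpM2r ?powR_ge0// le_max lexx orbT.
Qed.

Lemma addr4_ge1 (z : R) : 1 <= z -> 0 <= z + 4 <= 5 * z.
Proof. by move=> z1; apply/andP; split; lra. Qed.

Lemma addr4_le1 (z : R) : 0 <= z -> z <= 1 -> 0 <= z + 4 <= 5.
Proof. by move=> z0 z1; apply/andP; split; lra. Qed.

(** Here [nA] is the number of slabs in a box with sides [l0], [l1] and gauge [h], and [nS] the
    number of those meeting a set of diameter [r]. The conclusion is what averaging needs for that
    set. *)
Lemma step_ineq m (a s C C1 l0 l1 kap : R) (h : R -> R) (e : R) :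
  e = (1 + m%:R * a - s) / 8 ->
  1 / 2 < a -> a <= 1 -> 0 < m%:R * a -> m%:R * a <= s -> s < 1 + m%:R * a ->
  0 < C -> 0 < C1 -> 0 < l0 -> 0 < l1 -> 0 < kap ->
  (forall r, 0 < r -> r <= 1 ->
     Num.min 1 (5 ^+ m.+1 * 2 ^+ m.+2 * (Num.min 1 (r / l0) * Num.min 1 (r / l1) ^+ m)) <= h r) ->
  (forall r, 0 < r -> r <= 1 -> kap * r `^ s <= h r) ->
  exists K, forall k, (K <= k)%N -> forall w0 w1 r nA nS : R,
    0 < w0 -> 0 < w1 -> 0 < r -> r <= 1 -> Rk k `^ (- (1 / 2)) <= w0 ->
    w0 <= C * Rk k `^ (e - 1 / 2) -> w1 <= C * Rk k `^ (- a) ->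
    l0 / w0 * (l1 / w1) ^+ m <= 2 ^+ m.+2 * nA ->
    0 <= nS -> nS <= nA -> nS <= (Num.min r l0 / w0 + 4) * (Num.min r l1 / w1 + 4) ^+ m ->
    nS * gauge C1 s (Rk k) r <= nA * h r.
Proof.
move=> eE a12 a1 ma0 mas sa C0 C10 l00 l10 kap0 hbox hpow.
have [B BE] : exists B : R, B = 2 ^+ m.+2 * 5 by exists (2 ^+ m.+2 * 5).
have B0 : 0 <= B by rewrite BE mulr_ge0 ?exprn_ge0.
pose P := l0 * l1 ^+ m; have P0 : 0 < P by rewrite mulr_gt0 ?exprn_gt0.
have kP0 : 0 < kap * P by rewrite mulr_gt0.
have e0 : 0 < e by rewrite eE divr_gt0// subr_gt0.
have e18 : e <= 1 / 8 by rewrite eE; lra.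
have n1 : e - 1 / 2 < 0 by lra.
have n2 : - a < 0 by lra.
have n3 : 1 / 2 - a < 0 by lra.
(* As [e <= 1 / 8], the factor [1 / 2 - e] is at least 3/8, so the negative term is at least [3 * e]
   in size and outweighs [e]. *)
have n4 : e + (e - 1 / 2) * (m.+1%:R - s) < 0.
  have ms : 8 * e <= m.+1%:R - s.
    have : m%:R * a <= m%:R * 1 by rewrite ler_wpM2l ?ler0n.
    by rewrite -[m.+1%:R]natr1; lra.
  have : (3 / 8) * (8 * e) <= (1 / 2 - e) * (m.+1%:R - s).
    by apply: ler_pM => //; lra.
  by lra.
have n5 : - (7 * e) < 0 by lra.
have A1 : 0 <= B * 5 ^+ m * C * C1 * C `^ (m.+1%:R - s).
  by rewrite !mulr_ge0 ?exprn_ge0 ?powR_ge0 ?(ltW C0) ?(ltW C10).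
have A2 : 0 <= B * 5 ^+ m * C * C1 * C ^+ m.
  by rewrite !mulr_ge0 ?exprn_ge0 ?powR_ge0 ?(ltW C0) ?(ltW C10).
have [K1 hK1] := Rk_powR_mul_small n1 (ltW C0) l00.
have [K2 hK2] := Rk_powR_mul_small n2 (ltW C0) l10.
have [K3 hK3] := Rk_powR_mul_small n3 (ltW C0) ltr01.
have [K4 hK4] := Rk_powR_mul_small n4 A1 kP0.
have [K5 hK5] := Rk_powR_mul_small n5 A2 kP0.
exists (maxn K1 (maxn K2 (maxn K3 (maxn K4 K5)))) => k.
rewrite !geq_max => /andP[/hK1 h1 /andP[/hK2 h2 /andP[/hK3 h3 /andP[/hK4 h4 /hK5 h5]]]].
move=> w0 w1 r nA nS w00 w10 r0 r1 w0_ge w0C w1C hA nS0 nSA hS.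
have w1w0 : w1 <= w0.
  apply: le_trans w1C (le_trans _ w0_ge).
  have -> : - a = (1 / 2 - a) + - (1 / 2) by ring.
  by rewrite Rk_powRD mulrA ler_piMl ?powR_ge0.
have w0l := le_trans w0C h1; have w1l := le_trans w1C h2.
have g0 : 0 <= gauge C1 s (Rk k) r by rewrite gauge_ge0 ?ltW.
have nA0 : 0 <= nA by exact: le_trans nSA.
(* Coarse scale, [w0 <= r]: adding 4 to each factor costs at most a factor 5, the count is a volume
   fraction of the box times [nA], and the gauge is bounded by 1. *)
have [w0r|rw0] := leP w0 r.
  have w1r := le_trans w1w0 w0r.
  have minE l : 0 < l -> Num.min r l = Num.min 1 (r / l) * l.
    move=> lp; have [rl|lr] := leP r l.
      by rewrite min_r ?divfK ?gt_eqF// ler_pdivrMr// mul1r.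
    by rewrite min_l ?mul1r// ler_pdivlMr// mul1r ltW.
  have cell l w : 0 < w -> w <= r -> w <= l -> 0 < l ->
      0 <= Num.min r l / w + 4 <= 5 * (Num.min 1 (r / l) * (l / w)).
    move=> wp wr wl lp; rewrite (mulrA (Num.min 1 _)) -minE//.
    by apply: addr4_ge1; rewrite ler_pdivlMr// mul1r le_min wr.
  have /andP[c1 c2] := cell l0 w0 w00 w0r w0l l00.
  have /andP[c3 c4] := cell l1 w1 w10 w1r w1l l10.
  set X := Num.min 1 (r / l0) * Num.min 1 (r / l1) ^+ m.
  have X0 : 0 <= X.
    by rewrite mulr_ge0 ?exprn_ge0// le_min ler01 divr_ge0 ?(ltW r0) ?(ltW l00) ?(ltW l10).
  have nSX : nS <= nA * (5 ^+ m.+1 * 2 ^+ m.+2 * X).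
    apply: (le_trans hS); apply: (@le_trans _ _ (5 * (Num.min 1 (r / l0) * (l0 / w0)) *
      (5 * (Num.min 1 (r / l1) * (l1 / w1))) ^+ m)).
      by apply: ler_pM; rewrite ?exprn_ge0// lerXn2r ?nnegrE// (le_trans c3).
    rewrite [leLHS](_ : _ = 5 ^+ m.+1 * X * (l0 / w0 * (l1 / w1) ^+ m)); last first.
      by rewrite /X !exprMn exprS; ring.
    rewrite [leRHS](_ : _ = 5 ^+ m.+1 * X * (2 ^+ m.+2 * nA)); last by ring.
    by rewrite ler_wpM2l// mulr_ge0 ?exprn_ge0.
  apply: le_trans (_ : nS <= _); first by rewrite ler_piMr// gauge_le1.
  apply: le_trans (ler_wpM2l nA0 (hbox r r0 r1)).
  by have [_|_] := leP 1 (5 ^+ m.+1 * 2 ^+ m.+2 * X); rewrite ?mulr1.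
(* Fine scale, [r < w0]: the first factor of the count is at most 5, and the decay in [k] of the
   count times the gauge, relative to [nA], beats the fixed constant [kap * P]. *)
have W0 : 0 < w0 * w1 ^+ m by rewrite mulr_gt0 ?exprn_gt0.
have e1 : P <= 2 ^+ m.+2 * nA * (w0 * w1 ^+ m).
  rewrite -ler_pdivrMr//; apply: le_trans hA; rewrite /P expr_div_n.
  by rewrite [leLHS](_ : _ = l0 / w0 * (l1 ^+ m / w1 ^+ m))// invfM; ring.
have e2 : nS * (w0 * w1 ^+ m) <= 5 * w0 * (r + 4 * w1) ^+ m.
  have q1 : 0 <= Num.min r l0 / w0 + 4 <= 5.
    apply: addr4_le1; first by rewrite divr_ge0 ?(ltW w00)// le_min !ltW.
    by rewrite ler_pdivrMr// mul1r ge_min (ltW rw0).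
  have q2 : 0 <= Num.min r l1 / w1 + 4 <= r / w1 + 4.
    rewrite lerD2r ler_pM2r ?invr_gt0// ge_min lexx andbT addr_ge0// divr_ge0 ?(ltW w10)//.
    by rewrite le_min !ltW.
  move/andP: q1 => [q1 q1']; move/andP: q2 => [q2 q2'].
  have : nS <= 5 * (r / w1 + 4) ^+ m.
    apply: (le_trans hS); apply: ler_pM; rewrite ?exprn_ge0//.
    by rewrite lerXn2r ?nnegrE// (le_trans q2).
  rewrite -(ler_pM2r W0) => /le_trans; apply.
  rewrite [leLHS](_ : _ = 5 * w0 * ((r / w1 + 4) * w1) ^+ m); last by rewrite exprMn; ring.
  by rewrite [(r / w1 + 4) * w1]mulrDl divfK ?gt_eqF.
have e3 : B * w0 * (r + 4 * w1) ^+ m * gauge C1 s (Rk k) r <= kap * P * r `^ s.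
  apply: le_trans (fine_scale_bound eE C0 C10 B0 r0 w00 w10 w1w0 rw0 w0C w1C sa a1) _.
  by rewrite ler_wpM2r ?powR_ge0// ge_max h4.
rewrite -(ler_pM2r P0); apply: (@le_trans _ _ (nA * (kap * r `^ s) * P)); last first.
  by rewrite ler_wpM2r ?(ltW P0)// ler_wpM2l// hpow.
apply: (@le_trans _ _ (nS * gauge C1 s (Rk k) r * (2 ^+ m.+2 * nA * (w0 * w1 ^+ m)))).
  by rewrite ler_wpM2l// mulr_ge0.
rewrite [leLHS](_ : _ = nS * (w0 * w1 ^+ m) * (2 ^+ m.+2 * nA * gauge C1 s (Rk k) r)); last by ring.
have G0 : 0 <= 2 ^+ m.+2 * nA * gauge C1 s (Rk k) r.
  by apply: mulr_ge0 => //; apply: mulr_ge0 => //; exact: exprn_ge0.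
apply: le_trans (ler_wpM2r G0 e2) _.
rewrite [leLHS](_ : _ = nA * (B * w0 * (r + 4 * w1) ^+ m * gauge C1 s (Rk k) r));
  last by rewrite BE; ring.
rewrite [leRHS](_ : _ = nA * (kap * P * r `^ s)); last by ring.
by rewrite ler_wpM2l.
Qed.

End Gauge.

(** * Descent along nested slabs *)

Section Cost.
Variables (R : realType) (m : nat).
Implicit Types (U : nat -> set ('I_m.+1 -> R)) (r : nat -> R) (B : set ('I_m.+1 -> R)) (h : R -> R).

Definition cost U r B h : \bar R :=
  (\sum_(0 <= i <oo) (if `[< U i `&` B !=set0 >] then (h (r i))%:E else 0))%E.

Lemma cost_ge1 U r B h i : (forall i, 0 <= h (r i)) -> U i `&` B !=set0 -> h (r i) = 1 ->
  (1 <= cost U r B h)%E.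
Proof.
move=> h0 UB hi; pose u j := (if `[< U j `&` B !=set0 >] then (h (r j))%:E else 0)%E.
have u0 j : (0 <= u j)%E by rewrite /u; case: ifP => _; rewrite ?lee_fin.
rewrite /cost (nneseriesD1 (P := xpredT) (n := i) (f := u))//.
rewrite {1}/u ifT ?hi; last exact/asboolP.
by rewrite leeDl// nneseries_ge0.
Qed.

(** Averaging: after exchanging sums, the costs of all slabs add up to at most [#|A|] times the cost
    of [B], hence to less than [#|A|], so some slab costs less than 1. *)
Lemma cheap_child U r B h (I : finType) (A : {set I}) (S : I -> set ('I_m.+1 -> R)) g :
  (0 < #|A|)%N -> (forall x, x \in A -> S x `<=` B) ->
  (forall i, 0 <= h (r i)) -> (forall i, 0 <= g (r i)) ->
  (forall i, #|[set x in A | `[< U i `&` S x !=set0 >] ]%SET|%:R * g (r i) <= #|A|%:R * h (r i)) ->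
  (cost U r B h < 1)%E -> exists2 x, x \in A & (cost U r (S x) g < 1)%E.
Proof.
move=> A0 SB h0 g0 hcount hB; apply: contrapT => none.
have big x : x \in A -> (1 <= cost U r (S x) g)%E.
  by move=> xA; rewrite leNgt; apply/negP => lt1; apply: none; exists x.
have AR : 0 < #|A|%:R :> R by rewrite ltr0n.
suff : (#|A|%:R%:E <= #|A|%:R%:E * cost U r B h)%E.
  by rewrite -[X in (X <= _)%E]mule1 lee_pmul2l// leNgt hB.
apply: (@le_trans _ _ (\sum_(x in A) cost U r (S x) g)%E).
  have -> : (#|A|%:R%:E = \sum_(x in A) 1 :> \bar R)%E.
    by rewrite sumEFin sumr_const.
  exact: lee_sum.
pose u (x : I) i := (if `[< U i `&` S x !=set0 >] then (g (r i))%:E else 0)%E.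
have u0 x i : (0 <= u x i)%E by rewrite /u; case: ifP => _; rewrite ?lee_fin.
rewrite /cost -(@nneseries_sum _ _ (fun x => x \in A) R u 0%N)//.
rewrite -nneseriesZl; last by move=> i _; case: ifP => _; rewrite ?lee_fin.
apply: lee_nneseries => [i _ _|i _]; first exact: sume_ge0.
have -> : (\sum_(x in A) u x i =
    (#|[set x in A | `[< U i `&` S x !=set0 >] ]%SET|%:R * g (r i))%:E)%E.
  rewrite /u -big_mkcondr /= sumEFin; congr (_%:E); rewrite mulr_natl -sumr_const.
  by apply: eq_bigl => x; rewrite inE.
(* A set that misses [B] misses every slab inside [B], so its term vanishes on both sides. *)
case: ifPn => [_|/asboolPn disj]; first by rewrite -EFinM lee_fin.
rewrite mule0 (_ : [set x in A | _]%SET = finset.set0) ?finset.cards0 ?mul0r//.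
apply/finset.setP => x; rewrite !inE; apply/negP => /andP[xA /asboolP[z [zU zS]]].
by apply: disj; exists z; split=> //; exact: SB zS.
Qed.

End Cost.

Section Selection.
Variables (R : realType) (m : nat) (a s c : R).
Hypotheses (m_gt0 : (0 < m)%N) (a_gt : 3 / 4 < a) (a_le1 : a <= 1).
Hypotheses (s_gt1 : 1 < s) (s_gt : m%:R * a <= s) (s_lt : s < 1 + m%:R * a).
Hypotheses (c_gt0 : 0 < c) (c_le1 : c <= 1).

Let C0 : R := 5 ^+ m.+1 * 2 ^+ m.+2.
Let C1 : R := C0 / c ^+ m.+1.

Lemma count_const_gt0 : 0 < C0. Proof. by rewrite mulr_gt0 ?exprn_gt0. Qed.
Lemma gauge_const_gt0 : 0 < C1. Proof. by rewrite divr_gt0 ?exprn_gt0// count_const_gt0. Qed.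

(** A triple holds the level, the numerators and the denominator. *)
Definition slab_at (t : nat * (nat -> int) * nat) := slab m.+1 a (1 / 2) c t.1.1 t.1.2 t.2.

Definition valid (t : nat * (nat -> int) * nat) :=
  [/\ admissible m.+1 t.1.2 t.2, (1 <= t.2)%N & t.2%:R <= Qk m.+1 a (1 / 2) t.1.1].

(** The level is taken beyond [N] and the thresholds of [children] and [step_ineq]. The two lower
    bounds assumed of [h] are those that [gauge_slab] and [gauge_ge_pow] give for the gauge of the
    slab found, so the step can be iterated. *)
Lemma child_step U r b (l0 l1 kap : R) (h : R -> R) N :
  (forall i, 0 < r i) -> (forall i, r i <= 1) ->
  (forall i x y, U i x -> U i y -> forall j, `|x j - y j| <= r i) ->
  0 <= b ord0 -> 0 < l0 -> 0 < l1 -> 0 < kap ->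
  (forall r, 0 < r -> r <= 1 ->
     Num.min 1 (C0 * (Num.min 1 (r / l0) * Num.min 1 (r / l1) ^+ m)) <= h r) ->
  (forall r, 0 < r -> r <= 1 -> kap * r `^ s <= h r) ->
  (cost U r (box b l0 l1) h < 1)%E ->
  exists t, [/\ (N <= t.1.1)%N, valid t, slab_at t `<=` box b l0 l1 &
    (cost U r (slab_at t) (gauge C1 s (Rk t.1.1)) < 1)%E].
Proof.
move=> r0 r1 hU b0 l00 l10 kap0 hbox hpow hB.
have ma0 : 0 < m%:R * a by rewrite mulr_gt0 ?ltr0n// (lt_trans _ a_gt)// divr_gt0.
have [e eE] : exists e, e = (1 + m%:R * a - s) / 8 by exists ((1 + m%:R * a - s) / 8).
have sgt := s_gt; have slt := s_lt.
have e0 : 0 < e by rewrite eE divr_gt0// subr_gt0.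
have e12 : e < 1 / 2 by rewrite eE; lra.
have a12 : 1 / 2 < a by have := a_gt; lra.
have [C Cpos hC] := children m_gt0 a_gt a_le1 c_gt0 c_le1 e0 e12.
have [K1 hK1] := hC b l0 l1 l00 l10 b0.
have [K2 hK2] := step_ineq eE a12 a_le1 ma0 s_gt s_lt Cpos gauge_const_gt0 l00 l10 kap0 hbox hpow.
have Kk := leq_maxl N (maxn K1 K2).
have := hK1 _ (leq_trans (leq_maxl K1 K2) (leq_maxr N _)).
have := hK2 _ (leq_trans (leq_maxr K1 K2) (leq_maxr N _)).
move: (maxn N _) Kk => k Nk {hK1 hK2} hstep.
move=> [w0 [w1 [I [A [org [G [p [q [/andP[w0_ge w0C] /andP[w1_ge w1C] hA G_inj hx]]]]]]]]].
have w00 : 0 < w0 by rewrite (lt_le_trans _ w0_ge)// powR_gt0// Rk_gt0.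
have w10 : 0 < w1 by rewrite (lt_le_trans _ w1_ge)// invr_gt0 Rk_gt0.
have A0 : (0 < #|A|)%N.
  rewrite lt0n; apply/eqP => A0; move: hA; rewrite A0 mulr0 leNgt.
  by rewrite mulr_gt0 ?exprn_gt0 ?divr_gt0.
pose S x := slab m.+1 a (1 / 2) c k (p x) (q x).
have h0 i : 0 <= h (r i).
  by apply: le_trans (hpow _ (r0 i) (r1 i)); rewrite mulr_ge0 ?powR_ge0// ltW.
have g0 i : 0 <= gauge C1 s (Rk k) (r i) by rewrite gauge_ge0 ?ltW ?gauge_const_gt0.
have SB x : x \in A -> S x `<=` box b l0 l1 by move=> /hx[].
have hS x : x \in A -> S x `<=` box b l0 l1 /\ forall i,
    `|slab_center m.+1 a (1 / 2) k (p x) (q x) i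
      - (org i + (G x i)%:R * side w0 w1 i)| <= side w0 w1 i.
  by move=> /hx[].
have hcount i : #|[set x in A | `[< U i `&` S x !=set0 >] ]%SET|%:R * gauge C1 s (Rk k) (r i)
    <= #|A|%:R * h (r i).
  apply: (hstep w0 w1) => //.
    by rewrite ler_nat; apply: subset_leq_card; apply/fintype.subsetP => x; rewrite inE => /andP[].
  exact: meet_count c_gt0 c_le1 (r0 i) l00 l10 w0_ge w1_ge G_inj hS (@hU i).
have [x xA costx] := cheap_child A0 SB h0 g0 hcount hB.
have [adm q1 qQ sub _] := hx x xA.
by exists (k, p x, q x); split.
Qed.

End Selection.

(** Every lower corner lies below every upper corner, so the coordinatewise supremum of the lower
    corners is a common point. *)
Lemma nested_boxes (R : realType) (m : nat) (b : nat -> 'I_m.+1 -> R) (l0 l1 : nat -> R) :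
  (forall n, 0 <= l0 n) -> (forall n, 0 <= l1 n) ->
  (forall n, box (b n.+1) (l0 n.+1) (l1 n.+1) `<=` box (b n) (l0 n) (l1 n)) ->
  exists x, forall n, box (b n) (l0 n) (l1 n) x.
Proof.
move=> l00 l10 sub.
have subD n p : box (b (n + p)%N) (l0 (n + p)%N) (l1 (n + p)%N) `<=` box (b n) (l0 n) (l1 n).
  elim: p => [|p IH]; first by rewrite addn0.
  by rewrite addnS; apply: subset_trans IH; exact: sub.
have side0 n i : 0 <= side (l0 n) (l1 n) i by rewrite /side; case: ifP.
have corner n p i : b n i <= b (n + p)%N i <= b n i + side (l0 n) (l1 n) i.
  by apply: (subD n p) => j; rewrite lexx lerDl side0.
have le_corner n p i : b p i <= b n i + side (l0 n) (l1 n) i.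
  have /andP[_] := corner n p i; have /andP[+ _] := corner p n i.
  by rewrite addnC; exact: le_trans.
exists (fun i => sup (range (fun n => b n i))) => n i; apply/andP; split.
  apply: ub_le_sup; last by exists n.
  by exists (b 0%N i + side (l0 0%N) (l1 0%N) i) => _ [p _ <-].
by apply: ge_sup; [exists (b 0%N i), 0%N|move=> _ [p _ <-]].
Qed.

Section Escape.
Variables (R : realType) (m : nat) (a s c : R).
Hypotheses (m_gt0 : (0 < m)%N) (a_gt : 3 / 4 < a) (a_le1 : a <= 1).
Hypotheses (s_gt1 : 1 < s) (s_gt : m%:R * a <= s) (s_lt : s < 1 + m%:R * a).
Hypotheses (c_gt0 : 0 < c) (c_le1 : c <= 1).

Let C0 : R := 5 ^+ m.+1 * 2 ^+ m.+2.
Let C1 : R := C0 / c ^+ m.+1.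

Lemma gauge_eventually1 r : 0 < r -> exists K, forall k, (K <= k)%N -> gauge C1 s (Rk k) r = 1.
Proof.
move=> r0; have C10 : 0 < C1 by exact: gauge_const_gt0.
have half : (0 : R) < 1 / 2 by rewrite divr_gt0.
have [K1 hK1] := Rk_powR_large (C1 * r)^-1 half.
have [K2 hK2] := Rk_powR_large r^-1 (@ltr01 R).
exists (maxn K1 K2) => k; rewrite geq_max => /andP[/hK1 h1 /hK2].
rewrite powRr1 ?(ltW (Rk_gt0 _ _))// => h2.
apply/eqP; rewrite eq_le gauge_le1 /gauge le_min lexx /=.
have x1 : 1 <= r * Rk k by rewrite mulrC -ler_pdivrMr// div1r.
have -> : Num.min 1 ((r * Rk k) `^ (s - 1)) = 1.
  by rewrite min_l// -[leLHS](powRr0 (r * Rk k)) ler_powR// subr_ge0 ltW.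
rewrite mulr1 mulrA; move: h1; rewrite -(ler_pM2l (mulr_gt0 C10 r0)).
by rewrite mulfV// gt_eqF// mulr_gt0.
Qed.

Lemma escape U (r : nat -> R) b (l0 l1 kap : R) (h : R -> R) k0 :
  (forall i, 0 < r i) -> (forall i, r i <= 1) ->
  (forall i x y, U i x -> U i y -> forall j, `|x j - y j| <= r i) ->
  0 <= b ord0 -> 0 < l0 -> 0 < l1 -> 0 < kap ->
  (forall r, 0 < r -> r <= 1 ->
     Num.min 1 (C0 * (Num.min 1 (r / l0) * Num.min 1 (r / l1) ^+ m)) <= h r) ->
  (forall r, 0 < r -> r <= 1 -> kap * r `^ s <= h r) ->
  (cost U r (box b l0 l1) h < 1)%E ->
  exists x, [/\ box b l0 l1 x, Fdiv m.+1 a (1 / 2) c k0 x & forall i, ~ U i x].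
Proof.
move=> r0 r1 hU b0 l00 l10 kap0 hbox hpow hB.
have C10 : 0 < C1 by exact: gauge_const_gt0.
pose good (t : nat * (nat -> int) * nat) := [/\ (k0 <= t.1.1)%N, valid m a t,
  slab_at a c t `<=` box b l0 l1 & (cost U r (slab_at a c t) (gauge C1 s (Rk t.1.1)) < 1)%E].
have slabE (t : nat * (nat -> int) * nat) : slab_at a c t = box (slab_corner a c t.1.1 t.1.2 t.2)
    (c * Rk t.1.1 `^ (- (1 / 2))) (c * (Rk t.1.1)^-1) :> set ('I_m.+1 -> R) by exact: slab_box.
have sides (t : nat * (nat -> int) * nat) :
    0 < c * Rk t.1.1 `^ (- (1 / 2)) /\ 0 < c * (Rk t.1.1)^-1.
  by rewrite !mulr_gt0 ?powR_gt0 ?invr_gt0 ?Rk_gt0.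
have side_ge0 (t : nat * (nat -> int) * nat) (i : 'I_m.+1) :
    0 <= side (c * Rk t.1.1 `^ (- (1 / 2))) (c * (Rk t.1.1)^-1) i.
  by have [h1 h2] := sides t; rewrite /side; case: ifP => _; exact: ltW.
have [t0 good0] : exists t, good t.
  have [t [kt vt st ct]] := child_step m_gt0 a_gt a_le1 s_gt s_lt c_gt0 c_le1 k0
    r0 r1 hU b0 l00 l10 kap0 hbox hpow hB.
  by exists t; split.
have step t : exists t', good t -> [/\ good t', (t.1.1 < t'.1.1)%N &
    slab_at a c t' `<=` (slab_at a c t : set ('I_m.+1 -> R))].
  (* For a triple that is not good, [t] itself is the default, so that choice gives a total
     function. *)
  have [gt|] := pselect (good t); last by move=> ng; exists t.
  have [kt vt st ct] := gt; have [sd0 sd1] := sides t.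
  (* The corner is a point of the slab, hence of the initial box. *)
  have corner0 : 0 <= slab_corner a c t.1.1 t.1.2 t.2 (ord0 : 'I_m.+1).
    have : box b l0 l1 (slab_corner a c t.1.1 t.1.2 t.2).
      by apply: st; rewrite slabE => i; rewrite lexx lerDl side_ge0.
    by move=> /(_ ord0)/andP[+ _]; exact: le_trans.
  have kap'0 : 0 < Num.min 1 (C1 * Rk t.1.1 `^ (1 / 2)).
    by rewrite lt_min ltr01 mulr_gt0 ?powR_gt0 ?Rk_gt0.
  have sm : s - 1 <= m%:R.
    have : m%:R * a <= m%:R * 1 by rewrite ler_wpM2l ?ler0n.
    by have := s_lt; lra.
  rewrite slabE in ct.
  (* Levels increase strictly, which puts the limit point in infinitely many [Fk] and drives the
     gauge of each fixed radius to 1. *)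
  have [t' [kt' vt' st' ct']] := child_step m_gt0 a_gt a_le1 s_gt s_lt c_gt0 c_le1
    (maxn k0 t.1.1.+1) r0 r1 hU corner0 sd0 sd1 kap'0
    (fun r rp _ => gauge_slab t.1.1 (ltW (count_const_gt0 R m)) c_gt0 c_le1 (ltW s_gt1) sm rp)
    (fun r rp r1 => gauge_ge_pow (ltW C10) (Rk_ge1 R t.1.1) (ltW s_gt1) rp r1) ct.
  rewrite -slabE in st'; move: kt'; rewrite geq_max => /andP[kt'0 kt't].
  exists t' => _; split; [split|exact: kt't|exact: st'].
  - exact: kt'0.
  - exact: vt'.
  - exact: subset_trans st' st.
  - exact: ct'.
have [f fP] := choice step.
pose T n := iter n f t0.
have goodT n : good (T n).
  elim: n => [|n IH]; first exact: good0.
  by have [gT _ _] := fP _ IH; exact: gT.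
have subT n : slab_at a c (T n.+1) `<=` (slab_at a c (T n) : set ('I_m.+1 -> R)).
  by have [] := fP _ (goodT n).
have geT n : (n <= (T n).1.1)%N.
  by elim: n => // n IH; have [_ lt_n _] := fP _ (goodT n); exact: leq_ltn_trans IH lt_n.
have [x xT] : exists x : 'I_m.+1 -> R, forall n, slab_at a c (T n) x.
  have [|||x hx] := @nested_boxes R m (fun n => slab_corner a c (T n).1.1 (T n).1.2 (T n).2)
    (fun n => c * Rk (T n).1.1 `^ (- (1 / 2))) (fun n => c * (Rk (T n).1.1)^-1).
  - by move=> n; have [/ltW] := sides (T n).
  - by move=> n; have [_ /ltW] := sides (T n).
  - by move=> n; rewrite -!slabE.
  by exists x => n; rewrite slabE.
exists x; split.
- by have [_ _ sub _] := goodT 0%N; exact: sub (xT 0%N).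
- move=> N; exists (T N).1.1; have [kN [adm q1 qQ] _ _] := goodT N.
  by split=> //; exists (T N).1.2, (T N).2; split=> //; exact: (xT N).
(* The level of [T K] is at least [K], so [U i] alone would contribute 1 to a cost that is below
   1. *)
move=> i Uix; have [K hK] := gauge_eventually1 (r0 i).
have [_ _ _] := goodT K; apply/negP; rewrite -leNgt.
apply: (@cost_ge1 _ _ _ _ _ _ i); last exact/hK/geT.
  by move=> j; rewrite gauge_ge0 ?ltW.
by exists x; split=> //; exact: xT.
Qed.

End Escape.

(** * Hausdorff dimension *)

Section Hausdorff.
Variable R : realType.

Lemma edist_ge n (x y : 'I_n -> R) i : `|x i - y i| <= Defs.edist x y.
Proof.
rewrite /Defs.edist -sqrtr_sqr ler_sqrt; last by apply: sumr_ge0 => j _; exact: sqr_ge0.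
by rewrite (bigD1 i)//= lerDl; apply: sumr_ge0 => j _; exact: sqr_ge0.
Qed.

Lemma diam_ge0 n (V : set ('I_n -> R)) : (0 <= diam V)%E.
Proof. by apply: ereal_sup_ubound; left. Qed.

Lemma diam_coord n (V : set ('I_n -> R)) (d : R) x y i : (diam V <= d%:E)%E ->
  V x -> V y -> `|x i - y i| <= fine (diam V).
Proof.
move=> Vd Vx Vy; apply: le_trans (edist_ge x y i) _.
rewrite -lee_fin fineK; last by rewrite ge0_fin_numE ?diam_ge0// (le_lt_trans Vd) ?ltry.
by apply: ereal_sup_ubound; right; exists x => //; exists y.
Qed.

(* Singletons have diameter 0; they are given the radii [eta / 2 ^ i.+2], since the gauges need
   positive radii. *)
Lemma null_cover n (s0 s : R) (E : set ('I_n -> R)) (eta : R) : 0 <= s0 -> s0 < s -> 1 < s ->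
  hausdorff_measure s0 E = 0%E -> 0 < eta -> eta <= 1 ->
  exists (U : nat -> set ('I_n -> R)) (r : nat -> R),
  [/\ E `<=` \bigcup_i U i, (forall i, 0 < r i), (forall i, r i <= 1),
      (forall i x y, U i x -> U i y -> forall j, `|x j - y j| <= r i) &
      (\sum_(0 <= i <oo) ((r i) `^ s)%:E < eta%:E)%E].
Proof.
move=> s00 s0s s1 hE eta0 eta1; have eta2 : 0 < eta / 2 by rewrite divr_gt0.
have : (hausdorff_approx s0 1 E < (eta / 2)%:E)%E.
  apply: le_lt_trans (_ : 0 < _)%E; last by rewrite lte_fin.
  by rewrite -hE; apply: ereal_sup_ubound; exists 1 => //; exact: ltr01.
move=> /ereal_inf_lt[_ [U [EU dU ->]] hsum].
have d0 i : 0 <= fine (diam (U i)) by rewrite fine_ge0 ?diam_ge0.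
have d1 i : fine (diam (U i)) <= 1.
  by rewrite -lee_fin fineK ?dU// ge0_fin_numE ?diam_ge0// (le_lt_trans (dU i)) ?ltry.
pose t i : R := eta / 2 / (2 ^ i.+1)%:R.
have t0 i : 0 < t i by rewrite divr_gt0// ltr0n expn_gt0.
have t1 i : t i <= 1.
  rewrite ler_pdivrMr ?ltr0n ?expn_gt0// mul1r; apply: (@le_trans _ _ 1); first by lra.
  by rewrite ler1n expn_gt0.
exists U, (fun i => Num.max (fine (diam (U i))) (t i)); split=> //.
- by move=> i; rewrite lt_max t0 orbT.
- by move=> i; rewrite ge_max d1 t1.
- by move=> i x y Ux Uy j; rewrite le_max (diam_coord _ (dU i)).
apply: (@le_lt_trans _ _ (\sum_(0 <= i <oo) ((fine (diam (U i)) `^ s0)%:E + (t i)%:E))%E).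
  apply: lee_nneseries => [i _ _|i _]; first by rewrite lee_fin powR_ge0.
  (* If [t i] is the maximum, [t i <= 1 < s] gives [t i ^ s <= t i]; otherwise the diameter is at
     most 1 and [s0 < s] lowers the power. *)
  rewrite -EFinD lee_fin; have [dt|td] := leP (fine (diam (U i))) (t i).
    apply: le_trans (_ : t i <= _); last by rewrite lerDr powR_ge0.
    by rewrite ge1r_powR ?t0 ?t1// ltW.
  apply: le_trans (_ : fine (diam (U i)) `^ s0 <= _); last by rewrite lerDl ltW.
  by rewrite ger_powR ?(lt_trans (t0 i) td) ?d1// ltW.
have p0 i : (0 <= (fine (diam (U i)) `^ s0)%:E)%E by rewrite lee_fin powR_ge0.
apply: le_lt_trans (epsilon_trick xpredT p0 (ltW eta2)) _.
rewrite [X in (_ < X%:E)%E](splitr eta) EFinD lteD2rE//.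
Qed.

End Hausdorff.

Theorem theorem5p5 (R : realType) (n : nat) (a c0 : R) :
  (2 <= n)%N -> 3 / 4 < a -> a <= 1 -> 0 < c0 -> c0 <= 1 ->
  exists c1 : R, 0 < c1 /\
    forall (c : R) (k0 : nat), 0 < c -> c <= c1 ->
      ((1 + (n%:R - 1) * a)%:E <=
        hausdorff_dim (Fdiv n a (1 / 2) c k0 `&` cube n c0))%E.
Proof.
case: n => [//|m] m2 a_gt a_le1 c00 c01; have m_gt0 : (0 < m)%N by [].
(* With [c <= 1] a slab is no wider than a grid cell. *)
exists 1; split=> // c k0 c_gt0 c_le1.
apply: le_ereal_inf_tmp => _ [s0 [s00 hs0] <-]; rewrite lee_fin leNgt; apply/negP.
rewrite -[m.+1%:R]natr1 addrK => s0_lt.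
have ma0 : 0 < m%:R * a by rewrite mulr_gt0 ?ltr0n// (lt_trans _ a_gt)// divr_gt0.
(* The descent needs [s] above 1 and [m%:R * a], the cover needs it above [s0]; a midpoint with
   [1 + m%:R * a] does it. *)
have [s [s0s s1 sma s_lt]] : exists s, [/\ s0 < s, 1 < s, m%:R * a <= s & s < 1 + m%:R * a].
  exists ((Num.max s0 (Num.max 1 (m%:R * a)) + (1 + m%:R * a)) / 2).
  have : Num.max s0 (Num.max 1 (m%:R * a)) < 1 + m%:R * a.
    by rewrite !gt_max s0_lt ltrDl ma0 ltrDr ltr01.
  have : s0 <= Num.max s0 (Num.max 1 (m%:R * a)) by rewrite le_max lexx.
  have : 1 <= Num.max s0 (Num.max 1 (m%:R * a)) by rewrite !le_max lexx orbT.
  have : m%:R * a <= Num.max s0 (Num.max 1 (m%:R * a)) by rewrite !le_max lexx !orbT.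
  by move: (Num.max _ _) => z h1 h2 h3 h4; split; lra.
have C0_gt0 : 0 < 5 ^+ m.+1 * 2 ^+ m.+2 :> R by rewrite mulr_gt0 ?exprn_gt0.
(* This [kap] makes [kap * x ^ s] dominate the volume fraction of the cube, and a cover of total
   size below [1 / kap] then has cost below 1. *)
have [kap kapE] : exists kap : R, kap = 5 ^+ m.+1 * 2 ^+ m.+2 / c0 ^+ m.+1 by eexists.
have kap1 : 1 <= kap.
  rewrite kapE ler_pdivlMr ?exprn_gt0// mul1r (@le_trans _ _ 1) ?exprn_ile1 ?(ltW c00)//.
  by rewrite mulr_ege1 ?exprn_ege1 ?ler1n.
have kap0 : 0 < kap by exact: lt_le_trans kap1.
have kapV0 : 0 < kap^-1 by rewrite invr_gt0.
have kapV1 : kap^-1 <= 1 by rewrite invf_le1.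
have [U [r [EU r0 r1 hU hsum]]] := null_cover s00 s0s s1 hs0 kapV0 kapV1.
pose h (x : R) := kap * x `^ s.
have sm : s <= m.+1%:R.
  have : m%:R * a <= m%:R * 1 by rewrite ler_wpM2l ?ler0n.
  by rewrite -[m.+1%:R]natr1; lra.
have hbox x : 0 < x -> x <= 1 -> Num.min 1 (5 ^+ m.+1 * 2 ^+ m.+2 *
    (Num.min 1 (x / c0) * Num.min 1 (x / c0) ^+ m)) <= h x.
  move=> x0 x1; rewrite ge_min; apply/orP; right; rewrite -exprS.
  apply: (@le_trans _ _ (kap * x ^+ m.+1)); last first.
    by rewrite ler_wpM2l ?(ltW kap0)// -powR_mulrn ?(ltW x0)// ger_powR ?x0.
  rewrite kapE -[leRHS]mulrA ler_wpM2l ?(ltW C0_gt0)// [leRHS]mulrC -expr_div_n.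
  rewrite lerXn2r ?nnegrE ?divr_ge0 ?(ltW x0) ?(ltW c00)//.
    by rewrite le_min ler01 divr_ge0 ?(ltW x0) ?(ltW c00).
  by rewrite ge_min lexx orbT.
have cube_box : cube m.+1 c0 = box (fun=> 0) c0 c0 :> set ('I_m.+1 -> R).
  by apply/seteqP; split=> x hx i; have := hx i; rewrite /side if_same add0r.
have hcost : (cost U r (cube m.+1 c0) h < 1)%E.
  apply: (@le_lt_trans _ _ (kap%:E * \sum_(0 <= i <oo) ((r i) `^ s)%:E)%E).
    rewrite -nneseriesZl => [|i _]; last by rewrite lee_fin powR_ge0.
    apply: lee_nneseries => [i _ _|i _].
      by case: ifP => _; rewrite ?lee_fin// mulr_ge0 ?powR_ge0// ltW.
    by case: ifP => _; rewrite -EFinM lee_fin// mulr_ge0 ?powR_ge0// ltW.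
  rewrite -[X in (_ < X)%E](_ : (kap%:E * (kap^-1)%:E = 1)%E).
    by rewrite lte_pmul2l// lte_fin.
  by rewrite -EFinM mulfV// gt_eqF.
rewrite cube_box in hcost.
have [x [xbox xF xU]] := escape m_gt0 a_gt a_le1 s1 sma s_lt c_gt0 c_le1 k0
  r0 r1 hU (lexx 0) c00 c00 kap0 hbox (fun x _ _ => lexx (h x)) hcost.
have [|i _ Uix] := EU x; last exact: xU Uix.
by split=> //; rewrite cube_box.
Qed.
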